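(* Let $\mathcal{H}=(M,g,J)$ be a $4$-dimensional almost-Hermitian manifold which satisfies the Kähler identity $R(Jx,Jy)=R(x,y)$ for all tangent vectors $x,y$ (at the same point). Then $\mathcal{H}$ is complex Osserman if and only if $\mathcal{H}$ has constant holomorphic sectional curvature.
   Context: An almost-Hermitian manifold $\mathcal{H}=(M,g,J)$ is a Riemannian manifold $(M,g)$ with a smooth endomorphism $J$ of $TM$ satisfying $J^2=-\mathrm{Id}$ and $g(Jx,Jy)=g(x,y)$ (no integrability and no condition $\nabla J=0$ is assumed). With $\nabla$ the Levi-Civita connection, $R(x,y)=\nabla_x\nabla_y-\nabla_y\nabla_x-\nabla_{[x,y]}$ and $R(x,y,z,w)=g(R(x,y)z,w)$. The Jacobi operator is $\mathcal{J}(x):y\mapsto R(y,x)x$. A complex line is a $2$-dimensional subspace $\pi$ of a tangent space with $J\pi=\pi$; $\mathbb{CP}(\mathcal{H})$ is the bundle of all complex lines (over all points of $M$). The complex Jacobi operator is $\mathcal{J}(\pi)=\mathcal{J}(x)+\mathcal{J}(Jx)$ for any unit $x\in\pi$. $\mathcal{H}$ is complex Osserman if $J\mathcal{J}(\pi)=\mathcal{J}(\pi)J$ for every $\pi\in\mathbb{CP}(\mathcal{H})$ and the eigenvalues (with multiplicities) of $\mathcal{J}(\pi)$ are constant on $\mathbb{CP}(\mathcal{H})$. $\mathcal{H}$ has constant holomorphic sectional curvature if there is a constant $c$ with $s(x):=R(x,Jx,Jx,x)=c$ for all unit tangent vectors $x$ of $M$. *)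

(* Defs.v *)
From mathcomp Require Import all_boot all_order all_algebra.
From mathcomp Require Import all_classical all_reals all_analysis.
From mathcomp Require Import ring.

Set Implicit Arguments.
Unset Strict Implicit.
Unset Printing Implicit Defensive.

Import Order.TTheory GRing.Theory Num.Theory.
Import numFieldNormedType.Exports.

Local Open Scope classical_set_scope.
Local Open Scope ring_scope.

(* C^infinity maps on an open set O: all iterated directional derivatives are
   differentiable at every point of O.  Values of f outside O play no role. *)
Definition smooth_on (R : realType) (V W : normedModType R)
    (O : set V) (f : V -> W) : Prop :=
  forall (s : seq V) (x : V), O x ->
    differentiable (foldr (fun v (h : V -> W) => 'D_v h) f s) x.

Record smooth_manifold (R : realType) (n : nat) := SmoothManifold {
  carrier :> topologicalType ;
  carrier_hausdorff : hausdorff_space carrier ;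
  carrier_second_countable : @second_countable carrier ;
  chart : Type ;
  dom : chart -> set carrier ;
  phi : chart -> carrier -> 'rV[R]_n ;
  psi : chart -> 'rV[R]_n -> carrier ;
  dom_cover : forall p : carrier, exists i, dom i p ;
  dom_open : forall i, open (dom i) ;
  phi_open : forall i, open (phi i @` dom i) ;
  phiK : forall i p, dom i p -> psi i (phi i p) = p ;
  phi_continuous : forall i, {within dom i, continuous (phi i)} ;
  psi_continuous : forall i, {within phi i @` dom i, continuous (psi i)} ;
  transition_smooth : forall i j,
    smooth_on (phi i @` (dom i `&` dom j)) (phi j \o psi i)
}.

Definition transition (R : realType) (n : nat) (M : smooth_manifold R n)
    (i j : chart M) : 'rV[R]_n -> 'rV[R]_n := @phi R n M j \o @psi R n M i.

Definition bilin (R : realType) (n : nat) (g : 'M[R]_n) (v w : 'rV[R]_n) : R :=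
  (v *m g *m w^T) 0 0.

(* A tangent vector at p is given by its row vector of components in a chart i
   around p; the components in another chart j are obtained by applying the
   differential of [transition i j] at phi i p.  A tensor field is given by its
   components in each chart, as functions of the coordinates, subject to the
   corresponding transformation rule.  An endomorphism acts on row vectors by
   multiplication on the right. *)
Record almost_hermitian_manifold (R : realType) (n : nat) := AlmostHermitian {
  base :> smooth_manifold R n ;
  metric : chart base -> 'rV[R]_n -> 'M[R]_n ;
  acs : chart base -> 'rV[R]_n -> 'M[R]_n ;
  metric_smooth : forall i, smooth_on (phi i @` dom i) (metric i) ;
  acs_smooth : forall i, smooth_on (phi i @` dom i) (acs i) ;
  metric_transition : forall (i j : chart base) (x v w : 'rV[R]_n),
    (phi i @` (dom i `&` dom j)) x ->
    bilin (metric j (transition i j x))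
      ('d (transition i j) x v) ('d (transition i j) x w) =
    bilin (metric i x) v w ;
  acs_transition : forall (i j : chart base) (x v : 'rV[R]_n),
    (phi i @` (dom i `&` dom j)) x ->
    'd (transition i j) x v *m acs j (transition i j x) =
    'd (transition i j) x (v *m acs i x) ;
  metric_sym : forall i x v w, (phi i @` dom i) x ->
    bilin (metric i x) v w = bilin (metric i x) w v ;
  metric_pos : forall i x v, (phi i @` dom i) x -> v != 0 ->
    0 < bilin (metric i x) v v ;
  acs_sqr : forall i x, (phi i @` dom i) x -> acs i x *m acs i x = - 1%:M ;
  acs_isometry : forall i x v w, (phi i @` dom i) x ->
    bilin (metric i x) (v *m acs i x) (w *m acs i x) = bilin (metric i x) v w
}.

Section LeviCivita.
Variables (R : realType) (n : nat) (g : 'rV[R]_n -> 'M[R]_n).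
Implicit Types (X Y Z : 'rV[R]_n -> 'rV[R]_n) (x u v w : 'rV[R]_n).

Definition dmetric x (k i j : 'I_n) : R := ('D_(delta_mx 0 k) g x) i j.

Definition christoffel x (k i j : 'I_n) : R :=
  2^-1 * \sum_(l < n) invmx (g x) k l *
    (dmetric x i j l + dmetric x j i l - dmetric x l i j).

Definition nabla X Y : 'rV[R]_n -> 'rV[R]_n := fun x =>
  'D_(X x) Y x +
  \row_k \sum_(i < n) \sum_(j < n) X x 0 i * Y x 0 j * christoffel x k i j.

Definition lie_bracket X Y : 'rV[R]_n -> 'rV[R]_n := fun x =>
  'D_(X x) Y x - 'D_(Y x) X x.

Definition curvature_field X Y Z : 'rV[R]_n -> 'rV[R]_n := fun x =>
  nabla X (nabla Y Z) x - nabla Y (nabla X Z) x - nabla (lie_bracket X Y) Z x.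

(* [curvature_field] is tensorial, so its value on tangent vectors at x may be
   computed from any extension to vector fields; constant components are used. *)
Definition curvature x u v w : 'rV[R]_n :=
  curvature_field (cst u) (cst v) (cst w) x.

End LeviCivita.

Section Pointwise.
Variables (R : realType) (n : nat) (H : almost_hermitian_manifold R n).
Variables (i : chart H) (p : H).
Implicit Types (x y z w : 'rV[R]_n).

Definition g_at x y : R := bilin (metric i (phi i p)) x y.

Definition J_at : 'M[R]_n := acs i (phi i p).

Definition R_at x y z : 'rV[R]_n := curvature (metric i) (phi i p) x y z.

Definition R4_at x y z w : R := g_at (R_at x y z) w.

Definition hol_sect_curv x : R := R4_at x (x *m J_at) (x *m J_at) x.

Definition jacobi_op x : 'M[R]_n := lin1_mx (fun y => R_at y x x).

(* Subspaces of the tangent space at p are row spaces of matrices. *)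
Definition complex_line (P : 'M[R]_n) : Prop :=
  \rank P = 2%N /\ (P *m J_at == P)%MS.

Definition complex_jacobi_op (P A : 'M[R]_n) : Prop :=
  exists x, [/\ (x <= P)%MS, g_at x x = 1 &
    A = jacobi_op x + jacobi_op (x *m J_at)].

End Pointwise.

Section Global.
Variables (R : realType) (n : nat) (H : almost_hermitian_manifold R n).

Definition kaehler_identity : Prop :=
  forall (i : chart H) (p : H), dom i p -> forall x y z : 'rV[R]_n,
    R_at i p (x *m J_at i p) (y *m J_at i p) z = R_at i p x y z.

Definition complex_osserman : Prop :=
  (forall (i : chart H) (p : H) (P A : 'M[R]_n), dom i p ->
     complex_line i p P -> complex_jacobi_op i p P A ->
     comm_mx (J_at i p) A) /\
  (forall (i j : chart H) (p q : H) (P Q A B : 'M[R]_n), dom i p -> dom j q ->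
     complex_line i p P -> complex_jacobi_op i p P A ->
     complex_line j q Q -> complex_jacobi_op j q Q B ->
     forall l : R, \rank (eigenspace A l) = \rank (eigenspace B l)).

Definition constant_hol_sect_curv : Prop :=
  exists c : R, forall (i : chart H) (p : H) (x : 'rV[R]_n),
    dom i p -> g_at i p x x = 1 -> hol_sect_curv i p x = c.

End Global.

(* [nabla] is the Levi-Civita connection: it is torsion free and metric. *)

Lemma bilinE (R : realType) (n : nat) (g : 'M[R]_n) (v w : 'rV[R]_n) :
  bilin g v w = \sum_(a < n) \sum_(b < n) v 0 a * g a b * w 0 b.
Proof.
rewrite /bilin mxE exchange_big; apply: eq_bigr => b _.
by rewrite !mxE mulr_suml.
Qed.

Lemma is_derive_coord (R : realType) (n : nat) (Y : 'rV[R]_n -> 'rV[R]_n) x v a :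
  derivable Y x v -> is_derive x v (fun y => Y y 0 a) (('D_v Y x) 0 a).
Proof.
move=> dY; rewrite (derive_mx dY) mxE; apply: DeriveDef => //.
exact: (derivable_mxP Y x v).1 dY 0 a.
Qed.

Section LeviCivitaProperties.
Variables (R : realType) (n : nat) (H : almost_hermitian_manifold R n).
Variables (i : chart H) (x : 'rV[R]_n).
Hypothesis Ox : (phi i @` dom i) x.
Let g := metric i.

Lemma metric_symE y a b : (phi i @` dom i) y -> g y a b = g y b a.
Proof.
move=> Oy; have := metric_sym (delta_mx 0 a) (delta_mx 0 b) Oy.
rewrite /bilin !trmx_delta -!rowE -!colE.
by rewrite !mxE.
Qed.

Lemma metric_near_sym a b : \forall y \near x, g y a b = g y b a.
Proof.
have := @phi_open R n H i; rewrite openE => /(_ x Ox).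
by apply: filterS => y; exact: metric_symE.
Qed.

Lemma metric_unit : g x \in unitmx.
Proof.
rewrite -row_free_unit -kermx_eq0; apply/eqP/row_matrixP => k.
rewrite row0; apply/eqP/contraT => /(metric_pos Ox).
by rewrite /bilin -row_mul mulmx_ker row0 mul0mx mxE ltxx.
Qed.

Lemma metric_diff : differentiable g x.
Proof. exact: (@metric_smooth R n H i [::] x Ox). Qed.

Lemma dmetricE k a b : dmetric g x k a b = 'D_(delta_mx 0 k) (fun y => g y a b) x.
Proof.
rewrite /dmetric derive_mx ?mxE//; exact/diff_derivable/metric_diff.
Qed.

Lemma dmetric_sym k a b : dmetric g x k a b = dmetric g x k b a.
Proof. rewrite !dmetricE; apply: near_eq_derive; exact: metric_near_sym. Qed.

Lemma christoffel_sym k a b : christoffel g x k a b = christoffel g x k b a.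
Proof.
rewrite /christoffel; congr (_ * _); apply: eq_bigr => l _; congr (_ * _).
by rewrite (dmetric_sym l a b) (addrC (dmetric g x a b l)).
Qed.

Lemma nabla_torsion_free X Y :
  nabla g X Y x - nabla g Y X x = lie_bracket X Y x.
Proof.
rewrite /nabla /lie_bracket opprD addrACA -[RHS]addr0; congr (_ + _).
apply/eqP; rewrite subr_eq0; apply/eqP/rowP => k; rewrite !mxE exchange_big.
apply: eq_bigr => a _; apply: eq_bigr => b _.
by rewrite christoffel_sym (mulrC (X x 0 b)).
Qed.

Lemma christoffel_lower a b c :
  \sum_k christoffel g x k a b * g x k c =
  2^-1 * (dmetric g x a b c + dmetric g x b a c - dmetric g x c a b).
Proof.
rewrite /christoffel.
under eq_bigr => k _ do rewrite -mulrA mulr_suml.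
rewrite -mulr_sumr; congr (_ * _); rewrite exchange_big /=.
transitivity (\sum_l (g x *m invmx (g x)) c l *
    (dmetric g x a b l + dmetric g x b a l - dmetric g x l a b)).
  apply: eq_bigr => l _; rewrite mxE mulr_suml; apply: eq_bigr => k _.
  by rewrite (metric_symE k c Ox); ring.
rewrite mulmxV ?metric_unit// (bigD1 c)//= big1 ?addr0 => [|l /negPf lc].
  by rewrite mxE eqxx mul1r.
by rewrite mxE eq_sym lc mul0r.
Qed.

Lemma christoffel_metric a b c :
  \sum_k christoffel g x k a b * g x k c +
  \sum_k christoffel g x k a c * g x k b = dmetric g x a b c.
Proof.
by rewrite !christoffel_lower (dmetric_sym a c b); field.
Qed.

Lemma dmetric_dir v a b :
  'D_v (fun y => g y a b) x = \sum_k v 0 k * dmetric g x k a b.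
Proof.
have dgv : derivable g x v by exact/diff_derivable/metric_diff.
have := derive_mx dgv.
move=> /matrixP/(_ a b); rewrite mxE => <-.
have dE u : 'D_u g x = 'd g x u by apply: deriveE; exact: metric_diff.
rewrite dE /dmetric.
under [RHS]eq_bigr => k _ do rewrite dE.
have -> : 'd g x v = \sum_k v 0 k *: 'd g x (delta_mx 0 k).
  have vE := row_sum_delta v.
  have -> : 'd g x v = 'd g x (\sum_k v 0 k *: delta_mx 0 k) by congr ('d g x _).
  by rewrite linear_sum; apply: eq_bigr => k _; rewrite linearZ.
by rewrite summxE; apply: eq_bigr => k _; rewrite mxE.
Qed.

Lemma nabla_metric X Y Z :
  derivable Y x (X x) -> derivable Z x (X x) ->
  'D_(X x) (fun y => bilin (g y) (Y y) (Z y)) x =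
  bilin (g x) (nabla g X Y x) (Z x) + bilin (g x) (Y x) (nabla g X Z x).
Proof.
move=> dY dZ; set v := X x.
have dYa a : is_derive x v (fun y => Y y 0 a) (('D_v Y x) 0 a).
  exact: (is_derive_coord a dY).
have dZa a : is_derive x v (fun y => Z y 0 a) (('D_v Z x) 0 a).
  exact: (is_derive_coord a dZ).
have dg a b : is_derive x v (fun y => g y a b) (\sum_k v 0 k * dmetric g x k a b).
  apply: DeriveDef; last exact: dmetric_dir.
  have dgv : derivable g x v by exact/diff_derivable/metric_diff.
  exact: (derivable_mxP g x v).1 dgv a b.
have -> : (fun y => bilin (g y) (Y y) (Z y)) =
  \sum_(a < n) \sum_(b < n)
    ((fun y => Y y 0 a) * (fun y => g y a b) * (fun y => Z y 0 b)).
  apply/funext => y; rewrite bilinE fct_sumE; apply: eq_bigr => a _.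
  by rewrite fct_sumE.
have Gamma (W V : 'rV[R]_n) : bilin (g x)
    (\row_k \sum_(i < n) \sum_(j < n) v 0 i * W 0 j * christoffel g x k i j) V =
    \sum_j \sum_b W 0 j * V 0 b *
      \sum_k v 0 k * \sum_l christoffel g x l k j * g x l b.
  rewrite bilinE exchange_big [RHS]exchange_big; apply: eq_bigr => b _ /=.
  transitivity (\sum_l \sum_k \sum_j
     v 0 k * W 0 j * christoffel g x l k j * g x l b * V 0 b).
    apply: eq_bigr => l _; rewrite mxE !mulr_suml; apply: eq_bigr => k _.
    by rewrite !mulr_suml.
  rewrite exchange_big /=.
  under eq_bigr => k _ do rewrite exchange_big /=.
  rewrite exchange_big /=; apply: eq_bigr => j _.
  rewrite mulr_sumr; apply: eq_bigr => k _.
  rewrite !mulr_sumr; apply: eq_bigr => l _; ring.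
have bilDl u u' w : bilin (g x) (u + u') w = bilin (g x) u w + bilin (g x) u' w.
  by rewrite /bilin !mulmxDl mxE.
have bilDr u w w' : bilin (g x) u (w + w') = bilin (g x) u w + bilin (g x) u w'.
  by rewrite /bilin linearD mulmxDr mxE.
have -> : bilin (g x) (nabla g X Y x) (Z x) + bilin (g x) (Y x) (nabla g X Z x) =
    bilin (g x) ('D_v Y x) (Z x) + bilin (g x) (Y x) ('D_v Z x) +
    \sum_a \sum_b Y x 0 a * Z x 0 b * \sum_k v 0 k * dmetric g x k a b.
  rewrite /nabla bilDl bilDr addrACA; congr (_ + _).
  rewrite Gamma [X in _ + X = _]metric_sym// Gamma [X in _ + X = _]exchange_big /=.
  rewrite -big_split; apply: eq_bigr => a _ /=.
  rewrite -big_split; apply: eq_bigr => b _ /=.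
  rewrite (mulrC (Z x 0 b)) -mulrDr -big_split; congr (_ * _).
  apply: eq_bigr => k _ /=; rewrite -mulrDr; congr (_ * _).
  by rewrite christoffel_metric.
rewrite derive_val !bilinE /= -!big_split; apply: eq_bigr => a _ /=.
rewrite -!big_split; apply: eq_bigr => b _ /=; rewrite /GRing.scale /=.
match goal with |- context[(?f * ?h) x] => change ((f * h) x) with (f x * h x) end; cbv beta; ring.
Qed.
End LeviCivitaProperties.

(* Main.v *)
Require Import Defs.
From mathcomp Require Import all_boot all_order all_algebra.
From mathcomp Require Import all_classical all_reals all_analysis.
From mathcomp Require Import ring lra.

(** At a point, a curvature tensor with the Kaehler symmetry is
    [R(x, y) = kap * omega(x, y) J + (B applied to the anti-self-dual part of
    x ^ y)] plus a mixed term, with [B] a symmetric endomorphism of the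
    3-dimensional space of anti-self-dual forms and [tr B = kap].  The operator
    [J(pi) = R(x, Jx) J] commutes with [J] and has two eigenvalues of
    multiplicity two, [m(x) + d(x)] and [m(x) - d(x)].  The eigenvalues are
    constant iff the mixed term vanishes, [kap] is constant and [B^2 = rho] is a
    constant scalar.  By Cayley-Hamilton either [B = kap / 3], which is constant
    holomorphic sectional curvature, or [rho = kap^2] and [kap - B] has rank one.

    The second alternative does occur algebraically (it is "exceptional" below)
    and is excluded by the second Bianchi identity.  Differentiating
    [R J = J R] gives [omega /\ [J, nabla J] = 0], hence [nabla J = 0].  Then
    the deficit [N = kap * Id - B], viewed as a 2-form with values in skew
    endomorphisms, satisfies [d^nabla N = 0] and [N(x, y) = c g(Mx, y) M] for
    any nonzero value [M] of [N]; differentiating [N M = M N] gives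
    [M /\ [M, nabla M] = 0], so [nabla M] is a multiple of [M].  Hence the
    curvature commutes with [M], which is impossible for [kap != 0]. *)

Set Implicit Arguments.
Unset Strict Implicit.
Unset Printing Implicit Defensive.

Import Order.TTheory GRing.Theory Num.Theory.
Import numFieldNormedType.Exports.

Local Open Scope classical_set_scope.
Local Open Scope ring_scope.

(** * Smooth scalar and matrix fields *)

(** No smooth unitary frame is ever built. A frame is chosen at a single point, linear algebra is
    done there, and the result is restated as identities in [g], [J] and the curvature alone; only
    these are differentiated, along the constant coordinate fields of a chart. Hence [exceptional]
    is a list of frame-free identities and not a normal form. The two alternatives come from signs:
    a symmetric 3 x 3 matrix with B^2 = rho has eigenvalues plus or minus sqrt rho, so either all
    three agree and B is scalar, or two of them cancel in the trace and rho = kap^2. Differentiation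
    needs the identities on an open set. Mean and squared deviation of J(pi) are the same at all
    points, so the choice between the alternatives is made once, and the exceptional one would hold
    throughout a chart. *)

Section DirectionalSmoothness.
Variables (R : realType) (V : normedModType R) (O : set V).
Hypothesis openO : open O.
Implicit Types (f g : V -> R) (k : nat).

(** [cont_diff 0] is already differentiability on [O]: the derivatives of order up to [k] are
    required to be differentiable. Recursion on the order turns the product and inverse rules into
    inductions on [k]. *)
Fixpoint cont_diff k f : Prop :=
  (forall x, O x -> differentiable f x) /\
  if k is k'.+1 then forall v, cont_diff k' ('D_v f) else True.

Definition dsmooth f := forall k, cont_diff k f.

Lemma near_open (P : V -> Prop) x :
  O x -> (forall y, O y -> P y) -> \forall y \near x, P y.
Proof.
by move=> Ox OP; move: (openO); rewrite openE => /(_ x Ox); apply: filterS.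
Qed.

Lemma derive_eq_on (W : normedModType R) (f g : V -> W) x v :
  {in O, f =1 g} -> O x -> 'D_v f x = 'D_v g x.
Proof.
move=> fg Ox; apply: near_eq_derive; apply: near_open => // y Oy.
by apply: fg; rewrite inE.
Qed.


(** The first-order expansion of [f] at [x] serves for [g], because only values near [x] enter
    it. *)
Lemma near_eq_differentiable (f g : V -> R) x :
  (\forall y \near x, f y = g y) -> differentiable f x -> differentiable g x.
Proof.
move=> fg df; have cdf := diff_continuous df.
have E : g \o shift x = cst (g x) + 'd f x +o_ 0 id.
  apply/eqaddoP => _ /posnumP[eps].
  have /eqaddoP/(_ _ (gt0 eps)) Ef := diff_locally df.
  have fg0 : \forall h \near 0, f (h + x) = g (h + x).
    by move: fg; rewrite (near_shift 0) subr0.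
  near=> h; rewrite !fctE /= -(near fg0 h)// -(nbhs_singleton fg).
  by near: h; apply: filterS Ef => h; rewrite !fctE.
apply/diff_locallyP; have dE := diff_unique cdf E.
by rewrite dE; split.
Unshelve. all: by end_near. Qed.

(** Derivation rules hold on [O] only, so a derivative and its closed formula may be different
    functions outside [O]; this lemma exchanges them. *)
Lemma eq_cont_diff k f g : {in O, f =1 g} -> cont_diff k f -> cont_diff k g.
Proof.
have base (h l : V -> R) x : {in O, h =1 l} -> O x -> differentiable h x -> differentiable l x.
  move=> hl Ox; apply: near_eq_differentiable; apply: near_open => // y Oy.
  by apply: hl; rewrite inE.
elim: k f g => [|k IHk] f g fg [Cf Df].
  by split=> // x Ox; apply: base fg Ox (Cf x Ox).
split=> [x Ox|v]; first exact: base fg Ox (Cf x Ox).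
by apply: IHk (Df v) => y /set_mem Oy; apply: derive_eq_on.
Qed.

Lemma eq_dsmooth f g : {in O, f =1 g} -> dsmooth f -> dsmooth g.
Proof. by move=> fg Sf k; apply: eq_cont_diff fg (Sf k). Qed.

Lemma dsmooth_continuous f x : dsmooth f -> O x -> {for x, continuous f}.
Proof. by move=> /(_ 0%N)[+ _] Ox => /(_ x Ox)/differentiable_continuous. Qed.

Lemma dsmooth_derivable f x v : dsmooth f -> O x -> derivable f x v.
Proof. by move=> /(_ 0%N)[+ _] Ox => /(_ x Ox)/diff_derivable. Qed.

Lemma dsmooth_derive_linear f x : dsmooth f -> O x -> linear (fun v => 'D_v f x).
Proof.
move=> /(_ 0%N)[Cf _] Ox a u v.
by rewrite !(deriveE _ (Cf x Ox)) linearP.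
Qed.

Lemma dsmooth_derive f v : dsmooth f -> dsmooth ('D_v f).
Proof. by move=> Sf k; have [_] := Sf k.+1; apply. Qed.

Lemma cont_diffW k f : cont_diff k.+1 f -> cont_diff k f.
Proof.
elim: k f => [|k IHk] f [Cf Df]; first by split.
by split=> // v; exact: IHk.
Qed.

Lemma cont_diff_cst k (c : R) : cont_diff k (fun=> c).
Proof.
elim: k c => [|k IHk] c; (split; first by move=> x _; exact: differentiable_cst) => // v.
rewrite (_ : 'D_v _ = fun=> 0) //.
by apply/funext => x; exact: derive_cst.
Qed.

Lemma cont_diffD k f g :
  cont_diff k f -> cont_diff k g -> cont_diff k (fun x => f x + g x).
Proof.
elim: k f g => [|k IHk] f g [Cf Df] [Cg Dg];
  (split; first by move=> x Ox; exact: differentiableD (Cf x Ox) (Cg x Ox)) => // v.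
apply: eq_cont_diff (IHk _ _ (Df v) (Dg v)) => x /set_mem Ox.
by rewrite -deriveD//; apply: diff_derivable; [exact: Cf|exact: Cg].
Qed.

Lemma cont_diffM k f g :
  cont_diff k f -> cont_diff k g -> cont_diff k (fun x => f x * g x).
Proof.
elim: k f g => [|k IHk] f g CDf CDg; have [Cf Df] := CDf; have [Cg Dg] := CDg.
  by split=> // x Ox; exact: differentiableM (Cf x Ox) (Cg x Ox).
split=> [x Ox|v]; first exact: differentiableM (Cf x Ox) (Cg x Ox).
have fDg := IHk _ _ (cont_diffW CDf) (Dg v).
have gDf := IHk _ _ (cont_diffW CDg) (Df v).
apply: eq_cont_diff (cont_diffD fDg gDf) => x /set_mem Ox.
by rewrite -[RHS]/('D_v (f * g) x) deriveM//; apply: diff_derivable; [exact: Cf|exact: Cg].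
Qed.

(** The derivative of 1/f is - (1/f)^2 Df, and the induction hypothesis for the same [f] covers the
    factors 1/f. *)
Lemma cont_diffV k f : (forall x, O x -> f x != 0) ->
  cont_diff k f -> cont_diff k (fun x => (f x)^-1).
Proof.
move=> f0; elim: k => [|k IHk] CDf; have [Cf Df] := CDf.
  by split=> // x Ox; exact: differentiableV (Cf x Ox) (f0 x Ox).
split=> [x Ox|v]; first exact: differentiableV (Cf x Ox) (f0 x Ox).
have If := IHk (cont_diffW CDf).
have := cont_diffM (cont_diff_cst k (-1)) (cont_diffM (cont_diffM If If) (Df v)).
apply: eq_cont_diff => x /set_mem Ox.
rewrite deriveV ?f0//; last by apply: diff_derivable; exact: Cf.
by rewrite /GRing.scale /= -expr2 exprVn; ring.
Qed.

Lemma dsmooth_cst (c : R) : dsmooth (fun=> c).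
Proof. by move=> k; exact: cont_diff_cst. Qed.

Lemma dsmoothD f g : dsmooth f -> dsmooth g -> dsmooth (fun x => f x + g x).
Proof. by move=> Sf Sg k; exact: cont_diffD. Qed.

Lemma dsmoothM f g : dsmooth f -> dsmooth g -> dsmooth (fun x => f x * g x).
Proof. by move=> Sf Sg k; exact: cont_diffM. Qed.

Lemma dsmoothV f : (forall x, O x -> f x != 0) -> dsmooth f ->
  dsmooth (fun x => (f x)^-1).
Proof. by move=> f0 Sf k; exact: cont_diffV. Qed.

Lemma dsmoothN f : dsmooth f -> dsmooth (fun x => - f x).
Proof.
move=> Sf; apply: eq_dsmooth (dsmoothM (dsmooth_cst (-1)) Sf) => x _.
by rewrite mulN1r.
Qed.

Lemma dsmoothB f g : dsmooth f -> dsmooth g -> dsmooth (fun x => f x - g x).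
Proof. by move=> Sf Sg; apply: dsmoothD => //; exact: dsmoothN. Qed.

Lemma dsmooth_sum (I : Type) (r : seq I) (P : pred I) (F : I -> V -> R) :
  (forall i, P i -> dsmooth (F i)) -> dsmooth (fun x => \sum_(i <- r | P i) F i x).
Proof.
move=> SF; elim: r => [|i r IHr].
  by apply: eq_dsmooth (dsmooth_cst 0) => x _; rewrite big_nil.
have [Pi|nPi] := boolP (P i).
  by apply: eq_dsmooth (dsmoothD (SF i Pi) IHr) => x _; rewrite big_cons Pi.
by apply: eq_dsmooth IHr => x _; rewrite big_cons (negPf nPi).
Qed.

Lemma dsmooth_prod (I : Type) (r : seq I) (P : pred I) (F : I -> V -> R) :
  (forall i, P i -> dsmooth (F i)) -> dsmooth (fun x => \prod_(i <- r | P i) F i x).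
Proof.
move=> SF; elim: r => [|i r IHr].
  by apply: eq_dsmooth (dsmooth_cst 1) => x _; rewrite big_nil.
have [Pi|nPi] := boolP (P i).
  by apply: eq_dsmooth (dsmoothM (SF i Pi) IHr) => x _; rewrite big_cons Pi.
by apply: eq_dsmooth IHr => x _; rewrite big_cons (negPf nPi).
Qed.

Lemma is_derive_line f (y u : V) (s : R) : derivable f (y + s *: u) u ->
  is_derive s 1 (fun t : R => f (y + t *: u)) ('D_u f (y + s *: u)).
Proof.
have E : (fun h : R => h^-1 *: (f (y + (h *: 1 + s) *: u) - f (y + s *: u))) =
    (fun h : R => h^-1 *: (f (h *: u + (y + s *: u)) - f (y + s *: u))).
  apply/funext => h; congr (_ *: (f _ - _)).
  by rewrite scalerDl addrCA [h *: 1]mulr1.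
move=> df; apply: DeriveDef.
  by move: df; rewrite /derivable/= E.
by rewrite /derive /= E.
Qed.

Lemma near_parallelogram (P : V -> Prop) (x u v : V) :
  (\forall y \near x, P y) -> exists2 d : R, 0 < d &
    forall s t : R, 0 <= s <= d -> 0 <= t <= d -> P (x + s *: u + t *: v).
Proof.
move=> /nbhs_ballP[r /= r0 Pr].
have N0 : 0 < `|u| + `|v| + 1 by rewrite ltr_wpDl// addr_ge0.
(* The summand 1 keeps the denominator positive when [u] and [v] vanish, and makes the final bound
   strict. *)
exists (r / (`|u| + `|v| + 1)); first exact: divr_gt0.
move=> s t /andP[s0 sd] /andP[t0 td]; apply: Pr.
rewrite -ball_normE /ball_ /= -addrA opprD addrA subrr add0r normrN.
apply: le_lt_trans (ler_normD _ _) _; rewrite !normrZ !ger0_norm//.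
apply: (@le_lt_trans _ _ (r / (`|u| + `|v| + 1) * (`|u| + `|v|))).
  by rewrite mulrDr lerD// ler_wpM2r.
by rewrite mulrAC ltr_pdivrMr// ltr_pM2l// ltrDl.
Qed.

(** The mean value theorem twice: in [s], for the increment of [f] across [h *: v]; then in [t], for
    ['D_u f]. *)
Lemma second_difference f (x u v : V) (h : R) : dsmooth f -> 0 < h ->
  (forall s t : R, 0 <= s <= h -> 0 <= t <= h -> O (x + s *: u + t *: v)) ->
  exists s t, [/\ 0 <= s <= h, 0 <= t <= h &
    f (x + h *: u + h *: v) - f (x + h *: u) - f (x + h *: v) + f x =
    'D_v ('D_u f) (x + s *: u + t *: v) * h ^+ 2].
Proof.
move=> Sf h0 Oh.
have hh : 0 <= h <= h by rewrite lexx ltW.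
have h00 : 0 <= (0 : R) <= h by rewrite lexx ltW.
have Ou t s : 0 <= s <= h -> 0 <= t <= h -> O (x + t *: v + s *: u).
  by move=> sh th; rewrite addrAC; exact: Oh.
have Ou0 s : 0 <= s <= h -> O (x + s *: u).
  by move=> /Oh/(_ h00); rewrite scale0r addr0.
have dphi s : 0 <= s <= h -> is_derive s 1
    (fun s : R => f (x + h *: v + s *: u) - f (x + s *: u))
    ('D_u f (x + h *: v + s *: u) - 'D_u f (x + s *: u)).
  move=> sh; apply: is_deriveB; apply: is_derive_line.
    by apply: dsmooth_derivable => //; exact: Ou.
  by apply: dsmooth_derivable => //; exact: Ou0.
have icc (s : R) : s \in `]0, h[ -> 0 <= s <= h.
  by rewrite in_itv /= => /andP[/ltW-> /ltW->].
have [|s sh Es] := MVT h0 (fun s sh => dphi s (icc s sh)).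
  apply: derivable_within_continuous => s; rewrite in_itv /= => sh.
  by have [] := dphi s sh.
have {}sh := icc s sh.
have Sg := dsmooth_derive u Sf.
have dpsi t : 0 <= t <= h -> is_derive t 1
    (fun t : R => 'D_u f (x + s *: u + t *: v))
    ('D_v ('D_u f) (x + s *: u + t *: v)).
  by move=> th; apply: is_derive_line; apply: dsmooth_derivable => //; exact: Oh.
have [|t th Et] := MVT h0 (fun t th => dpsi t (icc t th)).
  apply: derivable_within_continuous => t; rewrite in_itv /= => th.
  by have [] := dpsi t th.
exists s, t; split=> //; first exact: icc.
move: Es Et; rewrite !scale0r !addr0 !subr0 [x + h *: v + h *: u]addrAC.
rewrite [x + h *: v + s *: u]addrAC => Es Et.
rewrite expr2 mulrA -Et -Es; ring.
Qed.

(** Schwarz's theorem. The second difference over a small parallelogram is symmetric in [u] and [v];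
    divided by [h ^+ 2] it is a value of each mixed derivative near [x], and both are continuous at
    [x]. *)
Lemma derive_comm f (x u v : V) : dsmooth f -> O x ->
  'D_u ('D_v f) x = 'D_v ('D_u f) x.
Proof.
move=> Sf Ox.
have Suv := dsmooth_derive u (dsmooth_derive v Sf).
have Svu := dsmooth_derive v (dsmooth_derive u Sf).
apply/eqP; rewrite -subr_eq0 -normr_eq0; apply/eqP/le_anti.
rewrite normr_ge0 andbT; apply/ler_addgt0Pl => e e0; rewrite addr0.
have e20 : 0 < e / 2 by rewrite divr_gt0.
have /cvgrPdist_lt/(_ _ e20) nuv := dsmooth_continuous Suv Ox.
have /cvgrPdist_lt/(_ _ e20) nvu := dsmooth_continuous Svu Ox.
have nO : \forall y \near x, O y by exact: near_open.
have [d1 d10 H1] := near_parallelogram u v (filterI (filterI nuv nvu) nO).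
have [d2 d20 H2] := near_parallelogram v u (filterI (filterI nuv nvu) nO).
pose h := Num.min d1 d2.
have h0 : 0 < h by rewrite lt_min d10.
have le1 (s : R) : 0 <= s <= h -> 0 <= s <= d1.
  by move=> /andP[-> /le_trans->//]; rewrite ge_min lexx.
have le2 (s : R) : 0 <= s <= h -> 0 <= s <= d2.
  by move=> /andP[-> /le_trans->//]; rewrite ge_min lexx orbT.
have [|s1 [t1 [s1h t1h E1]]] := @second_difference f x u v h Sf h0.
  by move=> s t /le1 sh /le1 th; have [] := H1 s t sh th.
have [|s2 [t2 [s2h t2h E2]]] := @second_difference f x v u h Sf h0.
  by move=> s t /le2 sh /le2 th; have [] := H2 s t sh th.
have [[_ B1] _] := H1 s1 t1 (le1 _ s1h) (le1 _ t1h).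
have [[B2 _] _] := H2 s2 t2 (le2 _ s2h) (le2 _ t2h).
have E : 'D_v ('D_u f) (x + s1 *: u + t1 *: v) =
         'D_u ('D_v f) (x + s2 *: v + t2 *: u).
  apply: (@mulIf _ (h ^+ 2)); first by rewrite expf_neq0// gt_eqF.
  apply: etrans (esym E1) _; apply: etrans _ E2.
  by rewrite [x + h *: v + h *: u]addrAC; congr (_ + _); exact: addrAC.
move: B1 B2 => /=; rewrite E => B1 B2.
rewrite -(subrKA ('D_u ('D_v f) (x + s2 *: v + t2 *: u))).
apply: le_trans (ler_normD _ _) _.
rewrite (splitr e); apply: lerD; first exact: ltW B2.
by rewrite distrC; exact: ltW B1.
Qed.

End DirectionalSmoothness.

(** * Smooth matrix-valued fields, treated entry by entry *)

Section MatrixFields.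
Variables (R : realType) (V : normedModType R) (O : set V).
Hypothesis openO : open O.

Definition msmooth m n (A : V -> 'M[R]_(m, n)) :=
  forall i j, dsmooth O (fun x => A x i j).

Lemma msmooth_derivable m n (A : V -> 'M[R]_(m, n)) x v :
  msmooth A -> O x -> derivable A x v.
Proof. by move=> SA Ox; apply/derivable_mxP => i j; exact: dsmooth_derivable (SA i j) Ox. Qed.

Lemma derive_coord m n (A : V -> 'M[R]_(m, n)) x v i j :
  derivable A x v -> ('D_v A x) i j = 'D_v (fun y => A y i j) x.
Proof. by move=> dA; rewrite derive_mx// mxE. Qed.

Lemma msmooth_derive m n (A : V -> 'M[R]_(m, n)) v : msmooth A -> msmooth ('D_v A).
Proof.
move=> SA i j; apply: (eq_dsmooth openO) (dsmooth_derive v (SA i j)) => x /set_mem Ox.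
by rewrite derive_coord//; exact: msmooth_derivable.
Qed.

Lemma eq_msmooth m n (A B : V -> 'M[R]_(m, n)) :
  {in O, A =1 B} -> msmooth A -> msmooth B.
Proof.
move=> AB SA i j; apply: (eq_dsmooth openO) (SA i j) => x Ox.
by rewrite AB.
Qed.

Lemma smooth_on_msmooth m n (A : V -> 'M[R]_(m, n)) : smooth_on O A -> msmooth A.
Proof.
move=> + i j k; elim: k A => [|k IHk] A SA.
all: have dA x : O x -> differentiable A x by move=> Ox; exact: (SA [::] x Ox).
all: split; first by move=> x Ox;
  exact: differentiable_comp (dA x Ox) (differentiable_coord _ _ _).
  by [].
move=> v.
have SDA : smooth_on O ('D_v A).
  (* [foldr] applies the last direction of the list first, hence [rcons]. *)
  by move=> s y Oy; have := SA (rcons s v) y Oy; rewrite foldr_rcons.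
apply: (eq_cont_diff openO) (IHk _ SDA) => y /set_mem Oy.
by rewrite derive_coord//; exact/diff_derivable/dA.
Qed.

Lemma msmooth_cst m n (A : 'M[R]_(m, n)) : msmooth (fun=> A).
Proof. by move=> i j; exact: dsmooth_cst. Qed.

Lemma msmoothD m n (A B : V -> 'M[R]_(m, n)) :
  msmooth A -> msmooth B -> msmooth (fun x => A x + B x).
Proof.
move=> SA SB i j; apply: (eq_dsmooth openO) (dsmoothD openO (SA i j) (SB i j)).
by move=> x _; rewrite mxE.
Qed.

Lemma msmoothZ m n (f : V -> R) (A : V -> 'M[R]_(m, n)) :
  dsmooth O f -> msmooth A -> msmooth (fun x => f x *: A x).
Proof.
move=> Sf SA i j; apply: (eq_dsmooth openO) (dsmoothM openO Sf (SA i j)).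
by move=> x _; rewrite mxE.
Qed.

Lemma msmoothN m n (A : V -> 'M[R]_(m, n)) : msmooth A -> msmooth (fun x => - A x).
Proof.
move=> SA i j; apply: (eq_dsmooth openO) (dsmoothN openO (SA i j)).
by move=> x _; rewrite mxE.
Qed.

Lemma msmoothB m n (A B : V -> 'M[R]_(m, n)) :
  msmooth A -> msmooth B -> msmooth (fun x => A x - B x).
Proof. by move=> SA SB; apply: msmoothD => //; exact: msmoothN. Qed.

Lemma msmoothT m n (A : V -> 'M[R]_(m, n)) : msmooth A -> msmooth (fun x => (A x)^T).
Proof.
move=> SA i j; apply: (eq_dsmooth openO) (SA j i).
by move=> x _; rewrite mxE.
Qed.

Lemma msmoothM m n p (A : V -> 'M[R]_(m, n)) (B : V -> 'M[R]_(n, p)) :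
  msmooth A -> msmooth B -> msmooth (fun x => A x *m B x).
Proof.
move=> SA SB i j.
apply: (eq_dsmooth openO) (dsmooth_sum openO (index_enum 'I_n) (P := xpredT)
  (F := fun k x => A x i k * B x k j) _) => [x _|k _]; first by rewrite mxE.
exact: dsmoothM.
Qed.

Lemma dsmooth_mxtrace n (A : V -> 'M[R]_n) : msmooth A -> dsmooth O (fun x => \tr (A x)).
Proof. by move=> SA; apply: dsmooth_sum. Qed.

Lemma dsmooth_det n (A : V -> 'M[R]_n) : msmooth A -> dsmooth O (fun x => \det (A x)).
Proof.
move=> SA; apply: dsmooth_sum => // s _; apply: dsmoothM => //.
  exact: dsmooth_cst.
exact: dsmooth_prod.
Qed.

(** Cramer's rule: cofactors are polynomial in the entries, and the determinant has no zero on
    [O]. *)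
Lemma msmoothV n (A : V -> 'M[R]_n) : (forall x, O x -> A x \in unitmx) ->
  msmooth A -> msmooth (fun x => invmx (A x)).
Proof.
move=> uA SA.
have SdetV : dsmooth O (fun x => (\det (A x))^-1).
  apply: dsmoothV => //; last exact: dsmooth_det.
  by move=> x Ox; have := uA x Ox; rewrite unitmxE unitfE.
have Sadj : msmooth (fun x => \adj (A x)).
  move=> i j; apply: (eq_dsmooth openO (f := fun x => cofactor (A x) j i)).
    by move=> x _; rewrite mxE.
  apply: dsmoothM => //; first exact: dsmooth_cst.
  apply: dsmooth_det => a b; apply: (eq_dsmooth openO) (SA (lift j a) (lift i b)).
  by move=> x _; rewrite !mxE.
apply: eq_msmooth (msmoothZ SdetV Sadj) => x /set_mem Ox.
by rewrite /invmx uA.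
Qed.

Section Rules.
Variables (x v : V).
Hypothesis Ox : O x.

Lemma msmooth_derive_linear m n (A : V -> 'M[R]_(m, n)) : msmooth A ->
  linear (fun u => 'D_u A x).
Proof.
move=> SA a u w; apply/matrixP => i j.
have E z : ('D_z A x) i j = 'D_z (fun y => A y i j) x.
  by apply: derive_coord; exact: msmooth_derivable.
rewrite mxE [X in _ = X + _]mxE (E (a *: u + w)) (E u) (E w).
exact: dsmooth_derive_linear (SA i j) Ox a u w.
Qed.

Lemma derive_msmoothD m n (A B : V -> 'M[R]_(m, n)) : msmooth A -> msmooth B ->
  'D_v (fun y => A y + B y) x = 'D_v A x + 'D_v B x.
Proof. by move=> SA SB; rewrite -deriveD//; exact: msmooth_derivable. Qed.

Lemma derive_msmoothB m n (A B : V -> 'M[R]_(m, n)) : msmooth A -> msmooth B ->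
  'D_v (fun y => A y - B y) x = 'D_v A x - 'D_v B x.
Proof. by move=> SA SB; rewrite -deriveB//; exact: msmooth_derivable. Qed.

Lemma derive_msmoothM m n p (A : V -> 'M[R]_(m, n)) (B : V -> 'M[R]_(n, p)) :
  msmooth A -> msmooth B ->
  'D_v (fun y => A y *m B y) x = 'D_v A x *m B x + A x *m 'D_v B x.
Proof.
move=> SA SB; apply/matrixP => i j.
rewrite derive_coord; last exact/msmooth_derivable/Ox/msmoothM.
have -> : (fun y => (A y *m B y) i j) =
    \sum_(k < n) ((fun y => A y i k) * (fun y => B y k j)).
  by apply/funext => y; rewrite mxE fct_sumE.
have dA k : derivable (fun y => A y i k) x v by exact: dsmooth_derivable (SA i k) Ox.
have dB k : derivable (fun y => B y k j) x v by exact: dsmooth_derivable (SB k j) Ox.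
rewrite derive_sum => [|k]; last exact: derivableM.
rewrite !mxE -big_split; apply: eq_bigr => k _ /=.
rewrite deriveM// /GRing.scale /= addrC.
by rewrite !derive_coord ?[_ * 'D_v (fun y => A y i k) x]mulrC//; exact: msmooth_derivable.
Qed.

Lemma derive_msmoothZ m n (f : V -> R) (A : V -> 'M[R]_(m, n)) :
  dsmooth O f -> msmooth A ->
  'D_v (fun y => f y *: A y) x = 'D_v f x *: A x + f x *: 'D_v A x.
Proof.
move=> Sf SA; apply/matrixP => i j.
rewrite derive_coord; last exact/msmooth_derivable/Ox/msmoothZ.
have -> : (fun y => (f y *: A y) i j) = f * (fun y => A y i j).
  by apply/funext => y; rewrite mxE.
have df := dsmooth_derivable (v := v) Sf Ox.
have dA := dsmooth_derivable (v := v) (SA i j) Ox.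
rewrite deriveM// mxE [X in _ = X + _]mxE [X in _ = _ + X]mxE.
have -> : ('D_v A x) i j = 'D_v (fun y => A y i j) x.
  by apply: derive_coord; exact: msmooth_derivable.
by rewrite addrC /GRing.scale /= [A x i j * _]mulrC.
Qed.

Lemma derive_msmoothT m n (A : V -> 'M[R]_(m, n)) : msmooth A ->
  'D_v (fun y => (A y)^T) x = ('D_v A x)^T.
Proof.
move=> SA; apply/matrixP => i j.
rewrite derive_coord; last exact/msmooth_derivable/Ox/msmoothT.
have -> : (fun y => (A y)^T i j) = (fun y => A y j i).
  by apply/funext => y; rewrite mxE.
by rewrite mxE derive_coord//; exact: msmooth_derivable.
Qed.

Lemma derive_msmooth_comm m n (A : V -> 'M[R]_(m, n)) (u : V) : msmooth A ->
  'D_u ('D_v A) x = 'D_v ('D_u A) x.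
Proof.
move=> SA; apply/matrixP => i j.
have dD a b : derivable ('D_a A) x b.
  by apply: msmooth_derivable Ox; exact: msmooth_derive.
apply: etrans (derive_coord i j (dD v u)) _.
apply: etrans _ (esym (derive_coord i j (dD u v))).
transitivity ('D_u ('D_v (fun y => A y i j)) x).
  apply: (derive_eq_on openO) => // y /set_mem Oy.
  by rewrite derive_coord//; exact: msmooth_derivable.
apply: etrans (derive_comm openO u v (SA i j) Ox) _.
apply: (derive_eq_on openO) => // y /set_mem Oy.
by rewrite derive_coord//; exact: msmooth_derivable.
Qed.

End Rules.
End MatrixFields.

(** * Kaehler curvature tensors at a point *)

(** Indices are iterated lifts because [big_ord_recl] produces them in this form, so that expanded
    sums match explicit entries. *)
Notation o0 := (ord0 : 'I_4).
Notation o1 := (lift ord0 ord0 : 'I_4).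
Notation o2 := (lift ord0 (lift ord0 ord0) : 'I_4).
Notation o3 := (lift ord0 (lift ord0 (lift ord0 ord0)) : 'I_4).

Lemma ord4P (P : 'I_4 -> Prop) : P o0 -> P o1 -> P o2 -> P o3 -> forall i, P i.
Proof.
move=> P0 P1 P2 P3 [[|[|[|[|//]]]] lt_i4].
- by rewrite (_ : Ordinal _ = o0)//; exact: val_inj.
- by rewrite (_ : Ordinal _ = o1)//; exact: val_inj.
- by rewrite (_ : Ordinal _ = o2)//; exact: val_inj.
- by rewrite (_ : Ordinal _ = o3)//; exact: val_inj.
Qed.

Ltac mx4 := apply/matrixP; apply: ord4P; apply: ord4P.

Section BilinTheory.
Variables (R : realType) (n : nat) (g : 'M[R]_n).
Implicit Types u v w : 'rV[R]_n.

Lemma bilinDl u v w : bilin g (u + v) w = bilin g u w + bilin g v w.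
Proof. by rewrite /bilin !mulmxDl mxE. Qed.

Lemma bilinZl a u v : bilin g (a *: u) v = a * bilin g u v.
Proof. by rewrite /bilin -!scalemxAl mxE. Qed.

Lemma bilinZr a u v : bilin g u (a *: v) = a * bilin g u v.
Proof. by rewrite /bilin linearZ -scalemxAr mxE. Qed.

Lemma bilinNl u v : bilin g (- u) v = - bilin g u v.
Proof. by rewrite -scaleN1r bilinZl mulN1r. Qed.

Lemma bilin0l u : bilin g 0 u = 0.
Proof. by rewrite -(scale0r 0) bilinZl mul0r. Qed.

Lemma mulmx_bilin (S : 'M[R]_n) i j :
  (S *m g *m S^T) i j = bilin g (row i S) (row j S).
Proof.
rewrite /bilin -row_mul !mxE; apply: eq_bigr => k _.
by rewrite !mxE.
Qed.

End BilinTheory.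

Lemma bilinMM (R : realType) n (g A B : 'M[R]_n) u v :
  bilin g (u *m A) (v *m B) = bilin (A *m g *m B^T) u v.
Proof. by rewrite /bilin trmx_mul !mulmxA. Qed.

Lemma bilin_inj (R : realType) n (g h : 'M[R]_n) :
  (forall u v, bilin g u v = bilin h u v) -> g = h.
Proof.
move=> gh; apply/matrixP => i j.
have := gh (delta_mx 0 i) (delta_mx 0 j).
by rewrite /bilin !trmx_delta -!rowE -!colE !mxE.
Qed.

Section HermitianStructure.
Variable R : realType.

Record compatible_acs n (g J : 'M[R]_n) : Prop := CompatibleAcs {
  herm_sym : g^T = g;
  herm_pos : forall v, v != 0 -> 0 < bilin g v v;
  herm_sqr : J *m J = - 1%:M;
  herm_isom : J *m g *m J^T = g }.

Section Theory.
Variables (n : nat) (g J : 'M[R]_n).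
Hypothesis hJ : compatible_acs g J.
Implicit Types u v w : 'rV[R]_n.

Lemma herm_bilinC u v : bilin g u v = bilin g v u.
Proof.
have trE (M : 'M[R]_1) : M 0 0 = M^T 0 0 by rewrite mxE.
by rewrite /bilin trE !trmx_mul trmxK (herm_sym hJ) mulmxA.
Qed.

Lemma herm_mulJJ u : u *m J *m J = - u.
Proof. by rewrite -mulmxA (herm_sqr hJ) mulmxN mulmx1. Qed.

Lemma herm_bilinJJ u v : bilin g (u *m J) (v *m J) = bilin g u v.
Proof. by rewrite bilinMM (herm_isom hJ). Qed.

Lemma herm_bilinJ u v : bilin g (u *m J) v = - bilin g u (v *m J).
Proof. by rewrite -herm_bilinJJ herm_mulJJ bilinNl. Qed.

Lemma herm_bilin_Jself u : bilin g u (u *m J) = 0.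
Proof.
apply/eqP; rewrite -[_ == 0](mulrn_eq0 _ 2) mulr2n -{1}[bilin _ _ _]opprK.
by rewrite -herm_bilinJ herm_bilinC addNr.
Qed.

Lemma herm_skew : J *m g + g *m J^T = 0.
Proof.
apply/eqP; rewrite addr_eq0; apply/eqP.
by rewrite -{1}(herm_isom hJ) !mulmxA (herm_sqr hJ) mulNmx mul1mx mulNmx.
Qed.

Lemma herm_unit : g \in unitmx.
Proof.
rewrite -row_free_unit -kermx_eq0; apply/eqP/row_matrixP => k.
rewrite row0; apply/eqP/contraT => /(herm_pos hJ).
by rewrite /bilin -row_mul mulmx_ker row0 mul0mx mxE ltxx.
Qed.

Lemma herm_scale_unit u : u != 0 -> exists2 c : R, 0 < c & bilin g (c *: u) (c *: u) = 1.
Proof.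
move=> /(herm_pos hJ) u0; exists (Num.sqrt (bilin g u u))^-1.
  by rewrite invr_gt0 sqrtr_gt0.
rewrite bilinZl bilinZr mulrA -expr2 exprVn sqr_sqrtr ?ltW//.
by rewrite mulVf// gt_eqF.
Qed.

End Theory.

Lemma ortho_two n (a b : 'cV[R]_n.+3) :
  exists2 y : 'rV[R]_n.+3, y != 0 & y *m a = 0 /\ y *m b = 0.
Proof.
have /rowV0Pn[y /sub_kermxP yab y0] : kermx (row_mx a b) != 0.
  rewrite -mxrank_eq0 mxrank_ker subn_eq0 -ltnNge.
  by apply: leq_ltn_trans (rank_leq_col _) _.
by exists y => //; apply: eq_row_mx; rewrite -mul_mx_row yab row_mx0.
Qed.

(* In a unitary frame [e, eJ, f, fJ]: the skew matrices commuting with [stdJ]. *)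
Definition skew4 (s0 s1 s2 s3 : R) : 'M[R]_4 := \matrix_(i < 4, j < 4)
  nth 0 (nth [::] [:: [:: 0; s0; s2; s3]; [:: - s0; 0; - s3; s2];
    [:: - s2; s3; 0; s1]; [:: - s3; - s2; - s1; 0]] i) j.

Definition stdJ : 'M[R]_4 := skew4 1 1 0 0.

(** Complex Gram-Schmidt: any unit [y] orthogonal to [x] and [x *m J] completes the frame. Having
    [x] as first row lets [pointwise_chsc] adapt the frame to a given complex line. *)
Lemma unitary_frame (g J : 'M[R]_4) x : compatible_acs g J -> bilin g x x = 1 ->
  exists S : 'M[R]_4, [/\ S *m g *m S^T = 1%:M, S *m J = stdJ *m S & row o0 S = x].
Proof.
move=> hJ x1.
have [y' y'0 [y'x y'Jx]] := ortho_two (g *m x^T) (g *m (x *m J)^T).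
have [c c0 y1] := herm_scale_unit hJ y'0; set y := c *: y' in y1.
have yx : bilin g y x = 0 by rewrite bilinZl /bilin -mulmxA y'x mxE mulr0.
have yJx : bilin g y (x *m J) = 0 by rewrite bilinZl /bilin -mulmxA y'Jx mxE mulr0.
have xy : bilin g x y = 0 by rewrite (herm_bilinC hJ).
have xJy : bilin g (x *m J) y = 0 by rewrite (herm_bilinC hJ).
have xyJ : bilin g x (y *m J) = 0 by rewrite (herm_bilinC hJ) (herm_bilinJ hJ) yJx oppr0.
have yJx' : bilin g (y *m J) x = 0 by rewrite (herm_bilinC hJ).
pose S : 'M[R]_4 := \matrix_(i < 4) nth 0 [:: x; x *m J; y; y *m J] i.
have rS i : row i S = nth 0 [:: x; x *m J; y; y *m J] i by rewrite rowK.
exists S; split; last by rewrite rS.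
  apply/matrixP; apply: ord4P; apply: ord4P; rewrite mulmx_bilin !rS !mxE /=;
  by rewrite ?(herm_bilinJJ hJ) ?(herm_bilin_Jself hJ) ?(herm_bilinJ hJ)
     ?(herm_bilin_Jself hJ) ?xyJ ?yJx ?oppr0.
have SE i k : S i k = nth 0 [:: x; x *m J; y; y *m J] i 0 k by rewrite mxE.
apply/row_matrixP; apply: ord4P; rewrite !row_mul rS /= ?(herm_mulJJ hJ);
  apply/rowP => k; rewrite [RHS]mxE !big_ord_recl big_ord0 !SE;
  by move: (x *m J) (y *m J) => a b; rewrite !mxE /=; ring.
Qed.

End HermitianStructure.

(** Vectors are rows, so R(u, v)w is [w *m Rm u v]. Linearity in the second slot follows from
    [kc_anti]. *)
Record kaehler_curvature (R : realType) n (g J : 'M[R]_n)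
    (Rm : 'rV[R]_n -> 'rV[R]_n -> 'M[R]_n) : Prop := KaehlerCurvature {
  kcD : forall u v w, Rm (u + v) w = Rm u w + Rm v w;
  kcZ : forall a u w, Rm (a *: u) w = a *: Rm u w;
  kc_anti : forall u v, Rm u v = - Rm v u;
  kc_skew : forall u v, Rm u v *m g + g *m (Rm u v)^T = 0;
  kc_bianchi : forall u v w, w *m Rm u v + u *m Rm v w + v *m Rm w u = 0;
  kc_kaehler : forall u v, Rm (u *m J) (v *m J) = Rm u v }.

Section KaehlerCurvature.
Variables (R : realType) (n : nat) (g J : 'M[R]_n).
Variable Rm : 'rV[R]_n -> 'rV[R]_n -> 'M[R]_n.
Hypotheses (hJ : compatible_acs g J) (kR : kaehler_curvature g J Rm).
Implicit Types u v w z x : 'rV[R]_n.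

Lemma kcDr u v w : Rm w (u + v) = Rm w u + Rm w v.
Proof. by rewrite (kc_anti kR) (kcD kR) opprD -!(kc_anti kR). Qed.

Lemma kcZr a u w : Rm w (a *: u) = a *: Rm w u.
Proof. by rewrite (kc_anti kR) (kcZ kR) -scalerN -(kc_anti kR). Qed.

Lemma kcN u w : Rm (- u) w = - Rm u w.
Proof. by rewrite -scaleN1r (kcZ kR) scaleN1r. Qed.

Lemma kcNr u w : Rm w (- u) = - Rm w u.
Proof. by rewrite -scaleN1r kcZr scaleN1r. Qed.

Lemma kc_bilin_skew u v w z :
  bilin g (w *m Rm u v) z = - bilin g (z *m Rm u v) w.
Proof.
have := congr1 (fun A => bilin A w z) (kc_skew kR u v).
rewrite [RHS](_ : _ = 0); last by rewrite /bilin mulmx0 mul0mx mxE.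
rewrite (herm_bilinC hJ (z *m _)) /bilin mulmxDr mulmxDl mxE trmx_mul !mulmxA.
by move/eqP; rewrite addr_eq0 => /eqP.
Qed.

Lemma kc_pair u v w z :
  bilin g (w *m Rm u v) z = bilin g (u *m Rm w z) v.
Proof.
pose r u v w z := bilin g (w *m Rm u v) z.
have ra a b c d : r a b c d = - r b a c d.
  by rewrite /r (kc_anti kR) mulmxN bilinNl.
have rs a b c d : r a b c d = - r a b d c by exact: kc_bilin_skew.
have rB a b c d : r a b c d + r b c a d + r c a b d = 0.
  by rewrite /r -!bilinDl (kc_bianchi kR) bilin0l.
rewrite -[LHS]/(r u v w z) -[RHS]/(r w z u v).
(* The octahedron argument: four Bianchi sums, each with a different vector in the last slot, and
   the two skew symmetries make the claim a linear consequence. *)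
have := rB u v w z; have := rB v w z u; have := rB w z u v; have := rB z u v w.
have := rs u v w z; have := rs v w u z; have := ra w u v z; have := rs u w v z.
have := rs w z v u; have := ra z v w u; have := rs v z w u; have := rs z u w v.
lra.
Qed.

(** Pair symmetry carries the Kaehler identity from the first pair of arguments to the second, where
    it says that the endomorphism commutes with [J]. *)
Lemma kc_commJ u v : Rm u v *m J = J *m Rm u v.
Proof.
suff: Rm u v *m J *m g = J *m Rm u v *m g.
  by move/(congr1 (mulmx^~ (invmx g))); rewrite !mulmxK ?(herm_unit hJ).
apply: bilin_inj => w z.
have E A : bilin (A *m g) w z = bilin g (w *m A) z by rewrite /bilin !mulmxA.
rewrite !E !mulmxA (herm_bilinJ hJ) kc_pair [RHS]kc_pair.
by rewrite -[in RHS](kc_kaehler kR) (herm_mulJJ hJ) kcN mulmxN bilinNl.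
Qed.

(** The first Bianchi identity for [u], [x *m J], [x], multiplied by [J]. It shows that the complex
    Jacobi operator depends on the single curvature value R(x, Jx). *)
Lemma kc_jacobi u x :
  x *m Rm u x + (x *m J) *m Rm u (x *m J) = u *m (Rm x (x *m J) *m J).
Proof.
have := congr1 (mulmx^~ J) (kc_bianchi kR u (x *m J) x).
have cJ w a b : w *m Rm a b *m J = w *m J *m Rm a b by rewrite -!mulmxA kc_commJ.
rewrite /= !mulmxDl mul0mx !cJ (herm_mulJJ hJ) (kc_anti kR x u) mulmxN mulNmx opprK.
rewrite mulmxA cJ (kc_anti kR x (x *m J)) mulmxN => /eqP.
by rewrite addrAC addr_eq0 addrC => /eqP.
Qed.

End KaehlerCurvature.

Section FrameTransfer.
Variables (R : realType) (g J S : 'M[R]_4).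
Hypotheses (hJ : compatible_acs g J).
Hypotheses (Sg : S *m g *m S^T = 1%:M) (SJ : S *m J = stdJ R *m S).

Lemma frame_inv : invmx S = g *m S^T.
Proof.
have [u _] := mulmx1_unit (etrans (mulmxA _ _ _) Sg).
by rewrite -[RHS]mul1mx -(mulVmx u) -!mulmxA (mulmxA S) Sg mulmx1.
Qed.

Lemma frame_unit : S \in unitmx.
Proof. by have [] := mulmx1_unit (etrans (mulmxA _ _ _) Sg). Qed.

Lemma frame_bilin u v : bilin g (u *m S) (v *m S) = bilin 1%:M u v.
Proof. by rewrite bilinMM Sg. Qed.

Lemma kaehler_curvature_frame Rm : kaehler_curvature g J Rm ->
  kaehler_curvature 1%:M (stdJ R) (fun u v => S *m Rm (u *m S) (v *m S) *m invmx S).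
Proof.
move=> kR; split=> [u v w|a u w|u v|u v|u v w|u v].
- by rewrite mulmxDl (kcD kR) mulmxDr mulmxDl.
- by rewrite -scalemxAl (kcZ kR) -scalemxAr -scalemxAl.
- by rewrite (kc_anti kR) mulmxN mulNmx.
- rewrite mulmx1 mul1mx frame_inv !trmx_mul trmxK (herm_sym hJ) !mulmxA.
  have := congr1 (fun A => S *m A *m S^T) (kc_skew kR (u *m S) (v *m S)).
  by rewrite mulmxDr mulmxDl mulmx0 mul0mx !mulmxA.
- by rewrite !mulmxA -!mulmxDl (kc_bianchi kR) mul0mx.
- by rewrite -!mulmxA -SJ !mulmxA (kc_kaehler kR).
Qed.

End FrameTransfer.

Section StandardFrame.
Variable R : realType.
Implicit Types x y z : 'rV[R]_4.

Lemma stdJ_compatible : compatible_acs 1%:M (stdJ R).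
Proof.
split; first by rewrite trmx1.
- move=> v v0; have [i vi] : exists i, v 0 i != 0.
    by apply/rV0Pn.
  rewrite /bilin mulmx1 mxE (bigD1 i)//= ltr_pwDl//.
    by rewrite mxE -expr2 exprn_even_gt0.
  by apply: sumr_ge0 => j _; rewrite mxE -expr2 sqr_ge0.
- by mx4; rewrite !mxE ?big_ord_recl ?big_ord0 !mxE /=; ring.
- by mx4; rewrite mulmx1 !mxE ?big_ord_recl ?big_ord0 !mxE /=; ring.
Qed.

Lemma skew4P (M : 'M[R]_4) : M + M^T = 0 -> M *m stdJ R = stdJ R *m M ->
  M = skew4 (M o0 o1) (M o2 o3) (M o0 o2) (M o0 o3).
Proof.
move=> sM cM.
have s i j : M i j = - M j i.
  by have /matrixP/(_ i j) := sM; rewrite !mxE => /eqP; rewrite addr_eq0 => /eqP.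
have e02 := congr1 (fun A : 'M[R]_4 => A o0 o3) cM.
have e03 := congr1 (fun A : 'M[R]_4 => A o0 o2) cM.
move: e02 e03; rewrite !mxE !big_ord_recl !big_ord0 !mxE /= => e02 e03.
have := s o0 o0; have := s o1 o1; have := s o2 o2; have := s o3 o3.
have := s o0 o1; have := s o0 o2; have := s o0 o3.
have := s o1 o2; have := s o1 o3; have := s o2 o3 => *.
by mx4; rewrite !mxE /=; lra.
Qed.

Lemma skew4D (a0 a1 a2 a3 b0 b1 b2 b3 : R) :
  skew4 a0 a1 a2 a3 + skew4 b0 b1 b2 b3 = skew4 (a0 + b0) (a1 + b1) (a2 + b2) (a3 + b3).
Proof. by mx4; rewrite !mxE /=; ring. Qed.

Lemma skew4Z (k a0 a1 a2 a3 : R) :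
  k *: skew4 a0 a1 a2 a3 = skew4 (k * a0) (k * a1) (k * a2) (k * a3).
Proof. by mx4; rewrite !mxE /=; ring. Qed.

Lemma skew4N (a0 a1 a2 a3 : R) :
  - skew4 a0 a1 a2 a3 = skew4 (- a0) (- a1) (- a2) (- a3).
Proof. by mx4; rewrite !mxE /=; ring. Qed.

Definition wedge x y (i j : 'I_4) : R := x 0 i * y 0 j - x 0 j * y 0 i.

(** Coordinates of the J-invariant part of x ^ y: [phi0 + phi1] is the component along the Kaehler
    form, while [phi0 - phi1], [phi2], [phi3] are the anti-self-dual ones. *)
Definition phi0 x y := wedge x y o0 o1.
Definition phi1 x y := wedge x y o2 o3.
Definition phi2 x y := wedge x y o0 o2 + wedge x y o1 o3.
Definition phi3 x y := wedge x y o0 o3 - wedge x y o1 o2.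

(* [p, q, t + u, a, b, c, d, t, e, u] are the values of the curvature form on the
   basis e01, e23, e02 + e13, e03 - e12 of the J-invariant bivectors; the entry
   [t + u] at (e01, e23) is forced by the first Bianchi identity. *)
Definition std_curv (p q t u a b c d e : R) x y : 'M[R]_4 :=
  let f0 := phi0 x y in let f1 := phi1 x y in
  let f2 := phi2 x y in let f3 := phi3 x y in
  skew4 (p * f0 + (t + u) * f1 + a * f2 + b * f3)
    ((t + u) * f0 + q * f1 + c * f2 + d * f3)
    (a * f0 + c * f1 + t * f2 + e * f3)
    (b * f0 + d * f1 + e * f2 + u * f3).

Lemma row4E x : x = x 0 o0 *: delta_mx 0 o0 + x 0 o1 *: delta_mx 0 o1 +
  x 0 o2 *: delta_mx 0 o2 + x 0 o3 *: delta_mx 0 o3.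
Proof. by rewrite {1}[x]row_sum_delta !big_ord_recl big_ord0 addr0 !addrA. Qed.

(** J-invariance and pair symmetry reduce the curvature to a symmetric form on a four-dimensional
    space, with ten coefficients; the Bianchi component read off in [bi] leaves nine. *)
Lemma std_curvP Rm : kaehler_curvature 1%:M (stdJ R) Rm ->
  exists p q t u a b c d e, forall x y, Rm x y = std_curv p q t u a b c d e x y.
Proof.
move=> kR.
pose E i : 'rV[R]_4 := delta_mx 0 i.
have sk x y : Rm x y = skew4 (Rm x y o0 o1) (Rm x y o2 o3) (Rm x y o0 o2) (Rm x y o0 o3).
  apply: skew4P; last exact: kc_commJ stdJ_compatible kR _ _.
  by have := kc_skew kR x y; rewrite mulmx1 mul1mx.
have EJ : [/\ E o0 *m stdJ R = E o1, E o1 *m stdJ R = - E o0,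
              E o2 *m stdJ R = E o3 & E o3 *m stdJ R = - E o2].
  by split; rewrite /E -rowE; apply/rowP; apply: ord4P; rewrite !mxE /= ?oppr0.
have [J0 J1 J2 J3] := EJ.
have R13 : Rm (E o1) (E o3) = Rm (E o0) (E o2) by rewrite -J0 -J2 (kc_kaehler kR).
have R12 : Rm (E o1) (E o2) = - Rm (E o0) (E o3).
  by rewrite -(kc_kaehler kR (E o0)) J0 J3 (kcNr kR) opprK.
have Rxx x : Rm x x = 0.
  have := kc_anti kR x x; move/eqP; rewrite -addr_eq0 -mulr2n => /eqP/matrixP RR.
  by apply/matrixP => i j; have := RR i j; rewrite !mxE; lra.
have bE M i j : bilin 1%:M (E i *m M) (E j) = M i j.
  by rewrite /bilin mulmx1 trmx_delta /E -rowE -colE !mxE.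
have pr i j k l : Rm (E i) (E j) k l = Rm (E k) (E l) i j.
  by rewrite -!bE (kc_pair stdJ_compatible kR).
have bi := congr1 (fun v : 'rV[R]_4 => v 0 o3) (kc_bianchi kR (E o0) (E o1) (E o2)).
have rowv (M : 'M[R]_4) i k : (E i *m M) 0 k = M i k by rewrite /E -rowE mxE.
move: bi; rewrite /= mxE [X in X + _]mxE !rowv mxE R12 (kc_anti kR (E o2)) !mxE => bi.
have p02 : Rm (E o0) (E o2) o1 o3 = Rm (E o0) (E o2) o0 o2 by rewrite pr R13.
exists (Rm (E o0) (E o1) o0 o1), (Rm (E o2) (E o3) o2 o3), (Rm (E o0) (E o2) o0 o2).
exists (Rm (E o0) (E o3) o0 o3), (Rm (E o0) (E o1) o0 o2), (Rm (E o0) (E o1) o0 o3).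
exists (Rm (E o2) (E o3) o0 o2), (Rm (E o2) (E o3) o0 o3), (Rm (E o0) (E o2) o0 o3).
move=> x y; rewrite [in LHS](row4E x) [in LHS](row4E y) -/(E _) -/(E o1) -/(E o2) -/(E o3).
rewrite !(kcD kR) !(kcDr kR) !(kcZ kR) !(kcZr kR) !Rxx !scaler0.
rewrite (kc_anti kR (E o1) (E o0)) (kc_anti kR (E o2) (E o0)) (kc_anti kR (E o3) (E o0)).
rewrite (kc_anti kR (E o2) (E o1)) (kc_anti kR (E o3) (E o1)) (kc_anti kR (E o3) (E o2)).
rewrite R12 R13 [Rm (E o0) (E o1)]sk [Rm (E o2) (E o3)]sk [Rm (E o0) (E o2)]sk [Rm (E o0) (E o3)]sk.
have p1 := pr o0 o1 o2 o3; have p2 := pr o0 o1 o0 o2; have p3 := pr o0 o1 o0 o3.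
have p4 := pr o0 o2 o0 o3; have p5 := pr o0 o2 o2 o3; have p6 := pr o0 o3 o2 o3.
have B : Rm (E o0) (E o1) o2 o3 = Rm (E o0) (E o2) o0 o2 + Rm (E o0) (E o3) o0 o3.
  move: bi; rewrite p02; lra.
rewrite -?p1 -?p2 -?p3 -?p4 ?p5 ?p6 B !(skew4N, skew4Z, skew4D, add0r, addr0).
rewrite /std_curv /phi0 /phi1 /phi2 /phi3 /wedge; cbv zeta.
move: (Rm (E o0) (E o1)) (Rm (E o0) (E o2)) (Rm (E o0) (E o3)) (Rm (E o2) (E o3)).
move: (x 0 o0) (x 0 o1) (x 0 o2) (x 0 o3) (y 0 o0) (y 0 o1) (y 0 o2) (y 0 o3).
by move=> *; congr skew4; rewrite !mxE /=; ring.
Qed.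
End StandardFrame.

(** * Operators with two eigenvalues symmetric about their mean *)

Section MeanDeviation.
Variable R : realType.
Implicit Types A B : 'M[R]_4.

(** The eigenvalues of a two-valued operator are [mean] plus or minus the square root of
    [deviation]. Unlike the eigenvalues, these two invariants are polynomial in the entries. *)
Definition mean A : R := \tr A / 4.
Definition deviation A : R :=
  \tr ((A - (mean A)%:M) *m (A - (mean A)%:M)) / 4.
Definition two_valued A : Prop :=
  (A - (mean A)%:M) *m (A - (mean A)%:M) = (deviation A)%:M /\ 0 <= deviation A.

Lemma eigenvalue_two_valued A l : two_valued A ->
  eigenvalue A l = ((l - mean A) ^+ 2 == deviation A).
Proof.
move=> [sqA _]; set m := mean A in sqA *; set r := deviation A in sqA *.
apply/eigenvalueP/eqP => [[v vA v0]|lr].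
  have vm : v *m (A - m%:M) = (l - m) *: v.
    by rewrite mulmxBr vA mul_mx_scalar scalerBl.
  have := congr1 (mulmx v) sqA; rewrite mulmxA vm -scalemxAl vm scalerA mul_mx_scalar.
  move/eqP; rewrite -expr2 -subr_eq0 -scalerBl scaler_eq0 (negPf v0) orbF subr_eq0.
  by move/eqP.
have prod0 : (A - l%:M) *m (A - m%:M + (l - m)%:M) = 0.
  have -> : A - l%:M = A - m%:M - (l - m)%:M.
    by rewrite raddfB /= opprB addrA subrK.
  move: sqA; move: (A - m%:M) => D sqA.
  rewrite mulmxDr !mulmxBl sqA -scalar_mxM -expr2 lr.
  by rewrite scalar_mxC addrA subrK subrr.
have : kermx (A - l%:M) != 0.
  rewrite kermx_eq0 row_free_unit; apply/negP => uA.
  (* If [A - l%:M] were invertible, the other factor would vanish; as [A - m%:M] is traceless, this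
     forces [l = m] and then [A = l%:M]. *)
  have D0 : A - m%:M + (l - m)%:M = 0.
    by rewrite -[LHS]mul1mx -(mulVmx uA) -mulmxA prod0 mulmx0.
  have lm : l = m.
    have := congr1 mxtrace D0; rewrite !raddfD raddfN /= !mxtrace_scalar mxtrace0.
    rewrite /m /mean; lra.
  move: D0; rewrite lm subrr raddf0 addr0 -lm => D0.
  by move: uA; rewrite D0 unitmxE det0 unitr0.
move=> /rowV0Pn[v /sub_kermxP vA v0]; exists v => //.
by move/eqP: vA; rewrite mulmxBr subr_eq0 mul_mx_scalar => /eqP.
Qed.

(** Each of the values m + sqrt r, m - sqrt r of one operator solves the equation of the other.
    Summing the four resulting equations leaves a multiple of the squared difference of the
    means. *)
Lemma two_valued_eq_spectrum A B : two_valued A -> two_valued B ->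
  (forall l, eigenvalue A l = eigenvalue B l) ->
  mean A = mean B /\ deviation A = deviation B.
Proof.
move=> tA tB AB; have [_ rA0] := tA; have [_ rB0] := tB.
have E l : ((l - mean A) ^+ 2 == deviation A) = ((l - mean B) ^+ 2 == deviation B).
  by rewrite -!eigenvalue_two_valued.
have sA := sqr_sqrtr rA0; have sB := sqr_sqrtr rB0.
move: E sA sB (sqrtr_ge0 (deviation A)) (sqrtr_ge0 (deviation B)).
move: (mean A) (mean B) (deviation A) (deviation B) => mA mB rA rB E.
move: (Num.sqrt rA) (Num.sqrt rB) => a b aE bE a0 b0.
have h1 : (mA + a - mB) ^+ 2 = rB.
  by apply/eqP; rewrite -E addrAC subrr add0r aE.
have h2 : (mA - a - mB) ^+ 2 = rB.
  by apply/eqP; rewrite -E addrAC subrr add0r sqrrN aE.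
have h3 : (mB + b - mA) ^+ 2 = rA.
  by apply/eqP; rewrite E addrAC subrr add0r bE.
have h4 : (mB - b - mA) ^+ 2 = rA.
  by apply/eqP; rewrite E addrAC subrr add0r sqrrN bE.
have d0 : (mA - mB) ^+ 2 * 2 = 0 by move: h1 h2 h3 h4; rewrite -aE -bE; nra.
have mAB : mA = mB.
  by apply/eqP; rewrite -subr_eq0 -(sqrf_eq0 (mA - mB)); apply/eqP; lra.
split=> //; move: h1; rewrite mAB addrAC subrr add0r aE //.
Qed.

Lemma two_valued_conj A (S : 'M[R]_4) : S \in unitmx ->
  [/\ mean (S *m A *m invmx S) = mean A,
      deviation (S *m A *m invmx S) = deviation A &
      two_valued (S *m A *m invmx S) -> two_valued A].
Proof.
move=> uS.
have tr B : \tr (S *m B *m invmx S) = \tr B.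
  by rewrite mxtrace_mulC mulmxA mulVmx // mul1mx.
have m : mean (S *m A *m invmx S) = mean A by rewrite /mean tr.
have cB : S *m A *m invmx S - (mean A)%:M = S *m (A - (mean A)%:M) *m invmx S.
  rewrite mulmxBr mulmxBl; congr (_ - _).
  by rewrite scalar_mxC -mulmxA mulmxV // mulmx1.
have cM B C : (S *m B *m invmx S) *m (S *m C *m invmx S) = S *m (B *m C) *m invmx S.
  by rewrite !mulmxA mulmxKV.
have d : deviation (S *m A *m invmx S) = deviation A.
  by rewrite /deviation m cB cM tr.
split=> //; rewrite /two_valued m d cB cM => -[sq r0]; split=> //.
have := congr1 (fun B => invmx S *m B *m S) sq.
by rewrite !mulmxA mulVmx // mul1mx mulmxKV // scalar_mxC -mulmxA mulVmx // mulmx1.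
Qed.

End MeanDeviation.

Section PointwiseAnalysis.
Variable R : realType.
Implicit Types x y z : 'rV[R]_4.

Definition complex_jacobi n (J : 'M[R]_n) (Rm : 'rV[R]_n -> 'rV[R]_n -> 'M[R]_n)
    (x : 'rV[R]_n) :=
  Rm x (x *m J) *m J.

Lemma skew4_jacobi (s0 s1 s2 s3 : R) (A := skew4 s0 s1 s2 s3 *m stdJ R) :
  [/\ two_valued A, mean A = - (s0 + s1) / 2 &
      deviation A = ((s0 - s1) / 2) ^+ 2 + s2 ^+ 2 + s3 ^+ 2].
Proof.
have mA : mean A = - (s0 + s1) / 2.
  by rewrite /mean /mxtrace !big_ord_recl big_ord0 !mxE !big_ord_recl !big_ord0 !mxE /=; field.
have sq : (A - (mean A)%:M) *m (A - (mean A)%:M) =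
    (((s0 - s1) / 2) ^+ 2 + s2 ^+ 2 + s3 ^+ 2)%:M.
  have -> : A - (mean A)%:M = \matrix_(i < 4, j < 4) nth 0 (nth [::]
      [:: [:: (s1 - s0) / 2; 0; - s3; s2]; [:: 0; (s1 - s0) / 2; - s2; - s3];
          [:: - s3; - s2; (s0 - s1) / 2; 0]; [:: s2; - s3; 0; (s0 - s1) / 2]] i) j.
    by rewrite mA; mx4; rewrite !mxE !big_ord_recl !big_ord0 !mxE /=; field.
  by mx4; rewrite !mxE !big_ord_recl !big_ord0 !mxE /=; field.
have dA : deviation A = ((s0 - s1) / 2) ^+ 2 + s2 ^+ 2 + s3 ^+ 2.
  by rewrite /deviation sq mxtrace_scalar; field.
split=> //; split; first by rewrite sq dA.
by rewrite dA !addr_ge0 ?sqr_ge0.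
Qed.

Definition rv4 (a b c d : R) : 'rV[R]_4 := \row_(i < 4) nth 0 [:: a; b; c; d] i.

Lemma std_bilin x y : bilin 1%:M x y =
  x 0 o0 * y 0 o0 + x 0 o1 * y 0 o1 + x 0 o2 * y 0 o2 + x 0 o3 * y 0 o3.
Proof.
by rewrite /bilin mulmx1 mxE !big_ord_recl big_ord0 !mxE addr0 !addrA.
Qed.

Lemma mul_stdJ x : x *m stdJ R = rv4 (- x 0 o1) (x 0 o0) (- x 0 o3) (x 0 o2).
Proof.
apply/rowP; apply: ord4P; rewrite mxE !big_ord_recl big_ord0 !mxE /=; ring.
Qed.

(** The Hopf map: the last two values and the difference of the first two form a vector of R^3 of
    length |x|^2, which parametrizes the complex lines. *)
Lemma phi_stdJ x :
  [/\ phi0 x (x *m stdJ R) = x 0 o0 ^+ 2 + x 0 o1 ^+ 2,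
      phi1 x (x *m stdJ R) = x 0 o2 ^+ 2 + x 0 o3 ^+ 2,
      phi2 x (x *m stdJ R) = 2 * (x 0 o1 * x 0 o2 - x 0 o0 * x 0 o3) &
      phi3 x (x *m stdJ R) = 2 * (x 0 o0 * x 0 o2 + x 0 o1 * x 0 o3)].
Proof.
by split; rewrite mul_stdJ /phi0 /phi1 /phi2 /phi3 /wedge !mxE /=; ring.
Qed.

Section FrameCoefficients.
Variables p q t u a b c d e : R.
Let Rm := std_curv p q t u a b c d e.

Lemma std_two_valued x : two_valued (complex_jacobi (stdJ R) Rm x).
Proof. by apply: (fun s0 s1 s2 s3 => let: And3 tv _ _ := skew4_jacobi s0 s1 s2 s3 in tv). Qed.

(** The overall minus sign arises because [p] is the (e0, e1) entry of R(e0, e1), which is minus a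
    sectional curvature. *)
Lemma std_hol x :
  let P := x 0 o0 ^+ 2 + x 0 o1 ^+ 2 in
  let Q := x 0 o2 ^+ 2 + x 0 o3 ^+ 2 in
  let v2 := 2 * (x 0 o1 * x 0 o2 - x 0 o0 * x 0 o3) in
  let v3 := 2 * (x 0 o0 * x 0 o2 + x 0 o1 * x 0 o3) in
  bilin 1%:M (x *m stdJ R *m Rm x (x *m stdJ R)) x =
  - (p * P ^+ 2 + q * Q ^+ 2 + 2 * (t + u) * P * Q + t * v2 ^+ 2 + u * v3 ^+ 2 +
     2 * a * P * v2 + 2 * b * P * v3 + 2 * c * Q * v2 + 2 * d * Q * v3 +
     2 * e * v2 * v3).
Proof.
move=> P Q v2 v3; rewrite std_bilin /Rm /std_curv.
have [-> -> -> ->] := phi_stdJ x; rewrite -/P -/Q -/v2 -/v3 mul_stdJ.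
rewrite !mxE !big_ord_recl !big_ord0 !mxE /=.
rewrite /P /Q /v2 /v3; ring.
Qed.

End FrameCoefficients.
End PointwiseAnalysis.

(** * Constancy of mean and deviation as an equation for a symmetric 3 x 3 matrix *)

Section OssermanAnalysis.
Variable R : realType.
Implicit Types x y z : 'rV[R]_4.

Section OssermanCoefficients.
Variables p q t u a b c d e : R.
Let Rm := std_curv p q t u a b c d e.

(** Put B = [[k, a, b], [a, t, e], [b, e, u]]. Once [q = p], [c = - a] and [d = - b], the deviation
    at [x] is |B h|^2, with h the Hopf vector of [x]; since |h| = |x|^2, the last six equations say
    B^2 = ro. *)
Lemma std_osserman al ro :
  (forall x, mean (complex_jacobi (stdJ R) Rm x) = al * bilin 1%:M x x) ->
  (forall x, deviation (complex_jacobi (stdJ R) Rm x) = ro * bilin 1%:M x x ^+ 2) ->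
  let k := (p - t - u) / 2 in
  [/\ q = p, c = - a, d = - b & p + t + u = - 2 * al] /\
  [/\ k ^+ 2 + a ^+ 2 + b ^+ 2 = ro, a ^+ 2 + t ^+ 2 + e ^+ 2 = ro,
      b ^+ 2 + e ^+ 2 + u ^+ 2 = ro &
      [/\ a * (k + t) + b * e = 0, b * (k + u) + a * e = 0 &
         a * b + e * (t + u) = 0]].
Proof.
move=> Hm Hd k.
have Em x : _ := esym (Hm x).
have Ed x : _ := esym (Hd x).
pose sk x (r0 r1 r2 r3 : R) := r0 * phi0 x (x *m stdJ R) + r1 * phi1 x (x *m stdJ R)
  + r2 * phi2 x (x *m stdJ R) + r3 * phi3 x (x *m stdJ R).
have Em' x : al * bilin 1%:M x x = - (sk x p (t + u) a b + sk x (t + u) q c d) / 2.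
  by rewrite Em; have [_ -> _] := skew4_jacobi (sk x p (t + u) a b)
    (sk x (t + u) q c d) (sk x a c t e) (sk x b d e u).
have Ed' x : ro * bilin 1%:M x x ^+ 2 =
    ((sk x p (t + u) a b - sk x (t + u) q c d) / 2) ^+ 2 +
      sk x a c t e ^+ 2 + sk x b d e u ^+ 2.
  by rewrite Ed; have [_ _ ->] := skew4_jacobi (sk x p (t + u) a b)
    (sk x (t + u) q c d) (sk x a c t e) (sk x b d e u).
have {}Em (x0 x1 x2 x3 : R) := Em' (rv4 x0 x1 x2 x3).
have {}Ed (x0 x1 x2 x3 : R) := Ed' (rv4 x0 x1 x2 x3).
have skE (x0 x1 x2 x3 r0 r1 r2 r3 : R) : sk (rv4 x0 x1 x2 x3) r0 r1 r2 r3 =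
    r0 * (x0 ^+ 2 + x1 ^+ 2) + r1 * (x2 ^+ 2 + x3 ^+ 2) +
    r2 * (2 * (x1 * x2 - x0 * x3)) + r3 * (2 * (x0 * x2 + x1 * x3)).
  by rewrite /sk; have [-> -> -> ->] := phi_stdJ (rv4 x0 x1 x2 x3); rewrite !mxE /=.
have nE (x0 x1 x2 x3 : R) : bilin 1%:M (rv4 x0 x1 x2 x3) (rv4 x0 x1 x2 x3) =
    x0 ^+ 2 + x1 ^+ 2 + x2 ^+ 2 + x3 ^+ 2.
  by rewrite std_bilin !mxE /= -!expr2.
(* The first two vectors have Hopf vectors on the first axis; the other two lie on the second and
   third axes and isolate [a + c] and [b + d]. *)
have M0 := Em 1 0 0 0; have M1 := Em 0 0 1 0.
have M2 := Em 0 1 1 0; have M3 := Em 1 0 1 0.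
move: M0 M1 M2 M3; rewrite !skE !nE => M0 M1 M2 M3.
have [qp ca db pal] : [/\ q = p, c = - a, d = - b & p + t + u = - 2 * al].
  by split; lra.
(* Hopf vectors on the three axes give the diagonal of B^2; those of [D3], [D4] and [D5] involve
   several coordinates and give the off-diagonal entries. *)
have D0 := Ed 1 0 0 0; have D1 := Ed 0 1 1 0; have D2 := Ed 1 0 1 0.
have D3 := Ed 0 2 1 0; have D4 := Ed 2 0 1 0; have D5 := Ed 1 1 1 0.
move: D0 D1 D2 D3 D4 D5; rewrite !skE !nE qp ca db => D0 D1 D2 D3 D4 D5.
split=> //.
have F0 : k ^+ 2 + a ^+ 2 + b ^+ 2 = ro by rewrite /k; lra.
have F1 : a ^+ 2 + t ^+ 2 + e ^+ 2 = ro by lra.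
have F2 : b ^+ 2 + e ^+ 2 + u ^+ 2 = ro by lra.
have F3 : a * (k + t) + b * e = 0 by move: F0; rewrite /k => F0; lra.
have F4 : b * (k + u) + a * e = 0 by move: F0 F3; rewrite /k => F0 F3; lra.
have F5 : a * b + e * (t + u) = 0 by move: F0 F3 F4; rewrite /k => F0 F3 F4; lra.
by [].
Qed.

End OssermanCoefficients.

(** If [s = 0] and [ro = s ^+ 2], the diagonal of B^2 is a sum of squares equal to zero, so B = 0.
    Otherwise [ro] differs from [s ^+ 2], which excludes eigenvalues of both signs. *)
Lemma sqr_scalar_sym3 (k t u a b e ro s : R) : k + t + u = s ->
  k ^+ 2 + a ^+ 2 + b ^+ 2 = ro -> a ^+ 2 + t ^+ 2 + e ^+ 2 = ro ->
  b ^+ 2 + e ^+ 2 + u ^+ 2 = ro -> a * (k + t) + b * e = 0 ->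
  b * (k + u) + a * e = 0 -> a * b + e * (t + u) = 0 ->
  ro != s ^+ 2 \/ s = 0 ->
  [/\ k = t, k = u & [/\ a = 0, b = 0 & e = 0]].
Proof.
move=> sE E1 E2 E3 E4 E5 E6.
have [ros [/eqP//|s0]|ros _] := eqVneq ro (s ^+ 2).
  have sq0 (w : R) : w ^+ 2 <= 0 -> w = 0.
    by move=> w0; apply/eqP; rewrite -sqrf_eq0 eq_le w0 sqr_ge0.
  move: E1 E2 E3; rewrite ros s0 expr0n /= => E1 E2 E3.
  have := sqr_ge0 k; have := sqr_ge0 t; have := sqr_ge0 u.
  have := sqr_ge0 a; have := sqr_ge0 b; have := sqr_ge0 e => *.
  have [k0 t0 u0] : [/\ k = 0, t = 0 & u = 0] by split; apply: sq0; lra.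
  have [a0 b0 e0] : [/\ a = 0, b = 0 & e = 0] by split; apply: sq0; lra.
  by rewrite k0 t0 u0.
(* Cayley-Hamilton: (ro - s ^+ 2) / 2 times the matrix
   [[k, a, b], [a, t, e], [b, e, u]] is scalar. *)
have kill (w : R) : w * s ^+ 2 = w * ro -> w = 0.
  by move=> ws; apply/eqP/contraT => /mulfI/(_ _ _ ws)/esym/eqP; rewrite (negPf ros).
have sa : a * s = a * u - b * e by rewrite -sE; lra.
have sb : b * s = b * t - a * e by rewrite -sE; lra.
have se : e * s = e * k - a * b by rewrite -sE; lra.
have a0 : a = 0.
  apply: kill; rewrite expr2 mulrA sa mulrBl [a * u * s]mulrAC [b * e * s]mulrAC sa sb.
  have -> : (a * u - b * e) * u - (b * t - a * e) * e =
    a * (b ^+ 2 + e ^+ 2 + u ^+ 2) - b * (a * b + e * (t + u)) by ring.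
  by rewrite E3 E6; ring.
have b0 : b = 0.
  apply: kill; rewrite expr2 mulrA sb mulrBl [b * t * s]mulrAC [a * e * s]mulrAC sb sa.
  by rewrite a0 in E2 *; rewrite -E2; ring.
have e0 : e = 0.
  apply: kill; rewrite expr2 mulrA se mulrBl [e * k * s]mulrAC [a * b * s]mulrAC se.
  by rewrite -E1 a0 b0; ring.
move: E1 E2 E3; rewrite a0 b0 e0 expr0n /= ?addr0 ?add0r => E1 E2 E3.
(* Two different diagonal entries would be opposite, so the third would equal [s], giving
   [ro = s ^+ 2]. *)
have opp (v w z : R) : v ^+ 2 = ro -> w ^+ 2 = ro -> z + v + w = s -> z ^+ 2 = ro -> v = w.
  move=> vr wr vwz zr; have /eqP : (v - w) * (v + w) = 0.
    by rewrite -subr_sqr vr wr subrr.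
  rewrite mulf_eq0 subr_eq0 => /orP[/eqP//|/eqP vw0].
  by move: ros; rewrite -vwz -addrA vw0 addr0 zr eqxx.
by split=> //; [apply: (opp _ _ u)|apply: (opp _ _ t)] => //; lra.
Qed.

End OssermanAnalysis.

(** * Exceptional curvature tensors *)

(** The bivector x ^ y as a skew endomorphism: it sends [z] to g(z, y) x - g(z, x) y. *)
Definition wedge_mx (R : realType) n (g : 'M[R]_n) (x y : 'rV[R]_n) : 'M[R]_n :=
  g *m (y^T *m x - x^T *m y).

(* The terms at [(x, y)] and [(xJ, yJ)] together project onto J-invariant bivectors. *)
Definition deficit (R : realType) n (g J : 'M[R]_n)
    (Rm : 'rV[R]_n -> 'rV[R]_n -> 'M[R]_n) (kap : R) (x y : 'rV[R]_n) : 'M[R]_n :=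
  - kap *: (wedge_mx g x y + wedge_mx g (x *m J) (y *m J)) - Rm x y.

(* What is used of the algebraic model in which [deficit] has rank one as a map
   from bivectors to endomorphisms; here [- \tr (M *m M) / 4] is the squared length
   of [M]. *)
Record exceptional (R : realType) (g J : 'M[R]_4)
    (Rm : 'rV[R]_4 -> 'rV[R]_4 -> 'M[R]_4) (kap : R) : Prop := Exceptional {
  ex_anti : forall x y X, X *m g + g *m X^T = 0 -> X *m J = - (J *m X) ->
    Rm x y *m X - X *m Rm x y = (kap * bilin (J *m g) x y) *: (J *m X - X *m J);
  ex_neq0 : exists z w, deficit g J Rm kap z w != 0;
  ex_comm : forall x y z w,
    deficit g J Rm kap x y *m deficit g J Rm kap z w =
    deficit g J Rm kap z w *m deficit g J Rm kap x y;
  ex_sqr : forall z w (M := deficit g J Rm kap z w), M *m M = (\tr (M *m M) / 4)%:M;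
  ex_sqr0 : forall z w (M := deficit g J Rm kap z w), \tr (M *m M) = 0 -> M = 0;
  ex_rank1 : forall x y z w (M := deficit g J Rm kap z w),
    (\tr (M *m M) / 4) *: deficit g J Rm kap x y =
    (- 2 * kap * bilin (M *m g) x y) *: M;
  ex_center : forall z w (M := deficit g J Rm kap z w),
    (forall x y, Rm x y *m M = M *m Rm x y) -> M = 0 }.

Section StandardExceptional.
Variable R : realType.
Implicit Types x y z w : 'rV[R]_4.

(** The nonzero trace provides a nonzero diagonal entry. The row through it serves as [n], the
    inverse of the entry as [tau], and the vanishing 2 x 2 minors give the rest. *)
Lemma rank1_sym3 (q11 q22 q33 q12 q13 q23 : R) : q11 + q22 + q33 != 0 ->
  q11 * q22 = q12 ^+ 2 -> q11 * q33 = q13 ^+ 2 -> q22 * q33 = q23 ^+ 2 ->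
  q11 * q23 = q12 * q13 -> q22 * q13 = q12 * q23 -> q33 * q12 = q13 * q23 ->
  exists tau n1 n2 n3, [/\ q11 = tau * n1 ^+ 2, q22 = tau * n2 ^+ 2,
    q33 = tau * n3 ^+ 2 & [/\ q12 = tau * n1 * n2, q13 = tau * n1 * n3 &
    q23 = tau * n2 * n3]].
Proof.
move=> tr0 e1 e2 e3 e4 e5 e6.
have div (q v w : R) : q != 0 -> q * v = w -> v = q^-1 * w.
  by move=> q0 <-; rewrite mulKf.
have [q1|q1] := eqVneq q11 0; last first.
  exists q11^-1, q11, q12, q13.
  rewrite (div _ _ _ q1 e1) (div _ _ _ q1 e2) (div _ _ _ q1 e4) ?mulrA.
  by split; [field|field|field|split; field].
have [q2|q2] := eqVneq q22 0; last first.
  exists q22^-1, q12, q22, q23.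
  rewrite (div _ _ _ q2 e3) (div _ _ _ q2 e5) ?mulrA.
  have -> : q11 = q22^-1 * q12 ^+ 2 by apply: div => //; rewrite mulrC.
  by split; [field|field|field|split; field].
have q3 : q33 != 0 by move: tr0; rewrite q1 q2 !add0r.
exists q33^-1, q13, q23, q33.
have -> : q11 = q33^-1 * q13 ^+ 2 by apply: div => //; rewrite mulrC.
have -> : q22 = q33^-1 * q23 ^+ 2 by apply: div => //; rewrite mulrC.
rewrite (div _ _ _ q3 e6) ?mulrA.
by split; [field|field|field|split; field].
Qed.

Lemma std_wedge (kap : R) x y :
  - kap *: (wedge_mx 1%:M x y + wedge_mx 1%:M (x *m stdJ R) (y *m stdJ R)) =
  skew4 (2 * kap * phi0 x y) (2 * kap * phi1 x y) (kap * phi2 x y) (kap * phi3 x y).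
Proof.
rewrite /wedge_mx !mul1mx !mul_stdJ; mx4;
  rewrite !mxE !big_ord_recl !big_ord0 !mxE /= /phi0 /phi1 /phi2 /phi3 /wedge; ring.
Qed.

Lemma std_anti (X : 'M[R]_4) : X + X^T = 0 -> X *m stdJ R = - (stdJ R *m X) ->
  X = \matrix_(i < 4, j < 4) nth 0 (nth [::]
    [:: [:: 0; 0; X o0 o2; X o0 o3]; [:: 0; 0; X o0 o3; - X o0 o2];
        [:: - X o0 o2; - X o0 o3; 0; 0]; [:: - X o0 o3; X o0 o2; 0; 0]] i) j.
Proof.
move=> sM cM.
have s i j : X i j = - X j i.
  by have /matrixP/(_ i j) := sM; rewrite !mxE => /eqP; rewrite addr_eq0 => /eqP.
have e02 := congr1 (fun A : 'M[R]_4 => A o0 o3) cM.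
have e03 := congr1 (fun A : 'M[R]_4 => A o0 o2) cM.
have e01 := congr1 (fun A : 'M[R]_4 => A o0 o0) cM.
have e23 := congr1 (fun A : 'M[R]_4 => A o2 o2) cM.
move: e02 e03 e01 e23; rewrite !mxE !big_ord_recl !big_ord0 !mxE /= => e02 e03 e01 e23.
have := s o0 o0; have := s o1 o1; have := s o2 o2; have := s o3 o3.
have := s o0 o1; have := s o0 o2; have := s o0 o3.
have := s o1 o2; have := s o1 o3; have := s o2 o3 => *.
by mx4; rewrite !mxE /=; lra.
Qed.

Section FrameCoefficients.
Variables p t u a b e kap : R.
Let Rm := std_curv p p t u a b (- a) (- b) e.
Hypothesis trE : p + t + u = 2 * kap.
Let k := (p - t - u) / 2.

(** The three rows of kap - B applied to the anti-self-dual coordinates of x ^ y. *)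
Let m1 x y := (kap - k) * (phi0 x y - phi1 x y) - a * phi2 x y - b * phi3 x y.
Let m2 x y := - a * (phi0 x y - phi1 x y) + (kap - t) * phi2 x y - e * phi3 x y.
Let m3 x y := - b * (phi0 x y - phi1 x y) - e * phi2 x y + (kap - u) * phi3 x y.

Lemma std_deficit x y : deficit 1%:M (stdJ R) Rm kap x y =
  skew4 (m1 x y) (- m1 x y) (m2 x y) (m3 x y).
Proof.
have kE : kap = (p + t + u) / 2 by have := trE; lra.
rewrite /deficit std_wedge /m1 /m2 /m3 /k kE.
by mx4; rewrite !mxE /=; field.
Qed.

Hypotheses (E1 : k ^+ 2 + a ^+ 2 + b ^+ 2 = kap ^+ 2)
  (E2 : a ^+ 2 + t ^+ 2 + e ^+ 2 = kap ^+ 2)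
  (E3 : b ^+ 2 + e ^+ 2 + u ^+ 2 = kap ^+ 2)
  (E4 : a * (k + t) + b * e = 0) (E5 : b * (k + u) + a * e = 0)
  (E6 : a * b + e * (t + u) = 0).
Hypothesis kap0 : kap != 0.

(** B^2 = kap^2 and tr B = kap give B the eigenvalues kap, kap, - kap, so kap - B has rank one and
    its trace is its only nonzero eigenvalue, 2 kap. *)
Lemma std_rank1 : exists tau n1 n2 n3,
  [/\ tau * (n1 ^+ 2 + n2 ^+ 2 + n3 ^+ 2) = 2 * kap,
    forall x y, m1 x y = tau * (n1 * (phi0 x y - phi1 x y) + n2 * phi2 x y + n3 * phi3 x y) * n1,
    forall x y, m2 x y = tau * (n1 * (phi0 x y - phi1 x y) + n2 * phi2 x y + n3 * phi3 x y) * n2 &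
    forall x y, m3 x y = tau * (n1 * (phi0 x y - phi1 x y) + n2 * phi2 x y + n3 * phi3 x y) * n3].
Proof.
have kE : k + t + u = kap by rewrite /k; have := trE; lra.
have [||||||| tau [n1 [n2 [n3 [h1 h2 h3 [h4 h5 h6]]]]]] :=
  @rank1_sym3 (kap - k) (kap - t) (kap - u) (- a) (- b) (- e).
- by rewrite (_ : _ + _ = 2 * kap); [rewrite mulf_neq0//|lra].
- by move: E1 E2 E3; rewrite -kE; lra.
- by move: E1 E2 E3; rewrite -kE; lra.
- by move: E1 E2 E3; rewrite -kE; lra.
- by move: E4 E5 E6; rewrite -kE; lra.
- by move: E4 E5 E6; rewrite -kE; lra.
- by move: E4 E5 E6; rewrite -kE; lra.
have [aE bE eE] : [/\ a = - (tau * n1 * n2), b = - (tau * n1 * n3) &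
  e = - (tau * n2 * n3)] by split; lra.
exists tau, n1, n2, n3; split.
- by rewrite !mulrDr -h1 -h2 -h3 -kE; lra.
- by move=> x y; rewrite /m1 h1 aE bE; ring.
- by move=> x y; rewrite /m2 h2 aE eE; ring.
- by move=> x y; rewrite /m3 h3 bE eE; ring.
Qed.

(** All deficits are multiples of one trace-free element n of u(2), and n^2 = - |n|^2; the
    commutation, square and rank clauses follow from this. *)
Lemma std_exceptional : exceptional 1%:M (stdJ R) Rm kap.
Proof.
have [tau [n1 [n2 [n3 [tauE E1m E2m E3m]]]]] := std_rank1.
pose s x y := tau * (n1 * (phi0 x y - phi1 x y) + n2 * phi2 x y + n3 * phi3 x y).
have dE x y : deficit 1%:M (stdJ R) Rm kap x y =
    skew4 (s x y * n1) (- (s x y * n1)) (s x y * n2) (s x y * n3).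
  by rewrite std_deficit E1m E2m E3m.
pose N2 : R := n1 ^+ 2 + n2 ^+ 2 + n3 ^+ 2.
have sqE x y z w : deficit 1%:M (stdJ R) Rm kap x y *m deficit 1%:M (stdJ R) Rm kap z w =
    (- (s x y * s z w * N2))%:M.
  rewrite !dE; mx4; rewrite !mxE !big_ord_recl !big_ord0 !mxE /= /N2; ring.
have trsq z w : \tr ((- (s z w * s z w * N2))%:M : 'M[R]_4) = - (s z w ^+ 2 * N2) * 4.
  by rewrite mxtrace_scalar; ring.
have four : (4 : R) != 0 by rewrite pnatr_eq0.
split.
(* The su(2) part of the curvature commutes with every such [X], so only the multiple of [J] acts,
   with coefficient kap times the Kaehler form. *)
- move=> x y X; rewrite mulmx1 mul1mx => sX cX.
  rewrite (std_anti sX cX) mulmx1 /Rm /std_curv.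
  move: (X o0 o2) (X o0 o3) => r v.
  rewrite (_ : bilin (stdJ R) x y = phi0 x y + phi1 x y); last first.
    by rewrite /bilin !mxE !big_ord_recl !big_ord0 !mxE !big_ord_recl !big_ord0 !mxE /=
      /phi0 /phi1 /wedge; ring.
  have -> : kap = (p + t + u) / 2 by have := trE; lra.
  by mx4; rewrite !mxE !big_ord_recl !big_ord0 !mxE /=; field.
- have kE : k + t + u = kap by rewrite /k; have := trE; lra.
  have phiE : [/\ phi0 (rv4 1 0 0 0) (rv4 0 1 0 0) = 1 :> R,
      phi1 (rv4 1 0 0 0) (rv4 0 1 0 0) = 0 :> R,
      phi2 (rv4 1 0 0 0) (rv4 0 1 0 0) = 0 :> R &
      phi3 (rv4 1 0 0 0) (rv4 0 1 0 0) = 0 :> R].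
    by split; rewrite /phi0 /phi1 /phi2 /phi3 /wedge !mxE /=; ring.
  have phiE2 : [/\ phi0 (rv4 1 0 0 0) (rv4 0 0 1 0) = 0 :> R,
      phi1 (rv4 1 0 0 0) (rv4 0 0 1 0) = 0 :> R,
      phi2 (rv4 1 0 0 0) (rv4 0 0 1 0) = 1 :> R &
      phi3 (rv4 1 0 0 0) (rv4 0 0 1 0) = 0 :> R].
    by split; rewrite /phi0 /phi1 /phi2 /phi3 /wedge !mxE /=; ring.
  have phiE3 : [/\ phi0 (rv4 1 0 0 0) (rv4 0 0 0 1) = 0 :> R,
      phi1 (rv4 1 0 0 0) (rv4 0 0 0 1) = 0 :> R,
      phi2 (rv4 1 0 0 0) (rv4 0 0 0 1) = 0 :> R &
      phi3 (rv4 1 0 0 0) (rv4 0 0 0 1) = 1 :> R].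
    by split; rewrite /phi0 /phi1 /phi2 /phi3 /wedge !mxE /=; ring.
  (* If all three deficits vanished, so would [kap - k], [kap - t] and [kap - u], whose sum is
     [2 * kap]. *)
  have [d1|] := eqVneq (deficit 1%:M (stdJ R) Rm kap (rv4 1 0 0 0) (rv4 0 1 0 0)) 0; last by eauto.
  have [d2|] := eqVneq (deficit 1%:M (stdJ R) Rm kap (rv4 1 0 0 0) (rv4 0 0 1 0)) 0; last by eauto.
  have [d3|] := eqVneq (deficit 1%:M (stdJ R) Rm kap (rv4 1 0 0 0) (rv4 0 0 0 1)) 0; last by eauto.
  have := congr1 (fun A : 'M[R]_4 => A o0 o1) d1.
  have := congr1 (fun A : 'M[R]_4 => A o0 o2) d2.
  have := congr1 (fun A : 'M[R]_4 => A o0 o3) d3.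
  rewrite !std_deficit !mxE /= /m1 /m2 /m3.
  have [-> -> -> ->] := phiE; have [-> -> -> ->] := phiE2; have [-> -> -> ->] := phiE3.
  by move=> f3 f2 f1; case/eqP: kap0; lra.
- by move=> x y z w; rewrite !sqE; congr (_%:M); ring.
- by move=> z w M; have -> : M *m M = _ := sqE z w z w; rewrite trsq; congr (_%:M); field.
- move=> z w M; have -> : M *m M = _ := sqE z w z w; rewrite trsq => /eqP; rewrite mulf_eq0 (negPf four) orbF oppr_eq0.
  rewrite mulf_eq0 sqrf_eq0 => /orP[/eqP s0|/eqP N0].
    by rewrite /M dE s0; mx4; rewrite !mxE /=; ring.
  by case/eqP: kap0; move: tauE; rewrite -/N2 N0 mulr0; lra.
- move=> x y z w M; have -> : M *m M = _ := sqE z w z w; rewrite trsq mulmx1.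
  rewrite (_ : bilin M x y = s z w * (n1 * (phi0 x y - phi1 x y) + n2 * phi2 x y + n3 * phi3 x y)); last first.
    rewrite /M dE /bilin !mxE !big_ord_recl !big_ord0 !mxE !big_ord_recl !big_ord0 !mxE /=.
    by rewrite /phi0 /phi1 /phi2 /phi3 /wedge; ring.
  rewrite (_ : - 2 * kap = - (tau * N2)); last by rewrite tauE; ring.
  by rewrite /M !dE /s; mx4; rewrite !mxE /=; field.
- move=> z w M cM.
  (* [M] commutes with the curvature and with all deficits, hence with their sums, which are
     projected wedges; two of these suffice to force [M = 0]. *)
  have cW x y : skew4 (2 * phi0 x y) (2 * phi1 x y) (phi2 x y) (phi3 x y) *m M =
      M *m skew4 (2 * phi0 x y) (2 * phi1 x y) (phi2 x y) (phi3 x y).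
    have : (deficit 1%:M (stdJ R) Rm kap x y + Rm x y) *m M =
           M *m (deficit 1%:M (stdJ R) Rm kap x y + Rm x y).
      have cD : deficit 1%:M (stdJ R) Rm kap x y *m M = M *m deficit 1%:M (stdJ R) Rm kap x y.
        by rewrite /M !sqE; congr (_%:M); ring.
      by rewrite [LHS]mulmxDl [RHS]mulmxDr cM cD.
    rewrite /deficit subrK std_wedge.
    have -> : skew4 (2 * kap * phi0 x y) (2 * kap * phi1 x y) (kap * phi2 x y)
        (kap * phi3 x y) = kap *: skew4 (2 * phi0 x y) (2 * phi1 x y) (phi2 x y) (phi3 x y).
      by mx4; rewrite !mxE /=; ring.
    by rewrite -scalemxAl -scalemxAr => /(scalerI kap0).
  have := cW (rv4 1 0 0 0) (rv4 0 1 0 0); have := cW (rv4 1 0 0 0) (rv4 0 0 1 0).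
  rewrite /M dE /phi0 /phi1 /phi2 /phi3 /wedge !mxE /=.
  move: (s z w * n1) (s z w * n2) (s z w * n3) => r1 r2 r3 C2 C1.
  have := congr1 (fun A : 'M[R]_4 => A o0 o1) C2.
  have := congr1 (fun A : 'M[R]_4 => A o0 o3) C2.
  have := congr1 (fun A : 'M[R]_4 => A o0 o2) C1.
  have := congr1 (fun A : 'M[R]_4 => A o0 o3) C1.
  rewrite !mxE !big_ord_recl !big_ord0 !mxE /= => f1 f2 f3 f4.
  by mx4; rewrite !mxE /=; lra.
Qed.

End FrameCoefficients.
End StandardExceptional.

(** * Transfer from the standard frame to an arbitrary tangent space *)

Section ArbitraryFrame.
Variables (R : realType) (g J : 'M[R]_4).
Variable Rm : 'rV[R]_4 -> 'rV[R]_4 -> 'M[R]_4.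
Hypotheses (hJ : compatible_acs g J) (kR : kaehler_curvature g J Rm).
Implicit Types x y z w : 'rV[R]_4.

(** The exponent [m.+1] makes the degree positive, so both sides vanish at the zero vector; other
    vectors are normalized. *)
Lemma homogeneous_unit (f : 'rV[R]_4 -> R) (c : R) m :
  (forall s x, f (s *: x) = (s ^+ 2) ^+ m.+1 * f x) ->
  (forall x, bilin g x x = 1 -> f x = c) ->
  forall x, f x = c * bilin g x x ^+ m.+1.
Proof.
move=> fZ f1 x; have [->|x0] := eqVneq x 0.
  by rewrite -(scale0r 0) fZ bilinZl mul0r !expr0n /= !mul0r mulr0.
have [s s0 sx] := herm_scale_unit hJ x0.
have s20 : (s ^+ 2) ^+ m.+1 != 0 by rewrite !expf_neq0 ?gt_eqF.
apply: (mulfI s20); rewrite -fZ f1 // mulrCA -exprMn.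
by move: sx; rewrite bilinZl bilinZr mulrA -expr2 => ->; rewrite expr1n mulr1.
Qed.

Lemma unit_vector : exists x, bilin g x x = 1.
Proof.
have d0 : delta_mx 0 o0 != 0 :> 'rV[R]_4.
  apply/negP => /eqP/matrixP/(_ 0 o0)/eqP; rewrite !mxE !eqxx /= oner_eq0 //.
by have [c _ c1] := herm_scale_unit hJ d0; eexists; exact: c1.
Qed.

Lemma complex_jacobiZ s x :
  complex_jacobi J Rm (s *: x) = s ^+ 2 *: complex_jacobi J Rm x.
Proof.
by rewrite /complex_jacobi -scalemxAl (kcZ kR) (kcZr kR) scalerA -scalemxAl expr2.
Qed.

Lemma meanZ (s : R) (A : 'M[R]_4) : mean (s *: A) = s * mean A.
Proof. by rewrite /mean mxtraceZ mulrA. Qed.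

Lemma deviationZ (s : R) (A : 'M[R]_4) : deviation (s *: A) = s ^+ 2 * deviation A.
Proof.
rewrite /deviation meanZ -scale_scalar_mx -scalerBr -scalemxAl -scalemxAr scalerA.
by rewrite mxtraceZ mulrA.
Qed.

Lemma holZ s x : bilin g (s *: x *m J *m Rm (s *: x) (s *: x *m J)) (s *: x) =
  (s ^+ 2) ^+ 2 * bilin g (x *m J *m Rm x (x *m J)) x.
Proof.
rewrite -!scalemxAl (kcZ kR) (kcZr kR) -!scalemxAr -?scalemxAl !bilinZl bilinZr; ring.
Qed.

Section Frame.
Variable S : 'M[R]_4.
Hypotheses (Sg : S *m g *m S^T = 1%:M) (SJ : S *m J = stdJ R *m S).
Let Rm' u v := S *m Rm (u *m S) (v *m S) *m invmx S.
Let uS : S \in unitmx := frame_unit Sg.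

Lemma frame_J x : x *m stdJ R *m S = x *m S *m J.
Proof. by rewrite -mulmxA -SJ mulmxA. Qed.

Lemma frame_JV : S *m J *m invmx S = stdJ R.
Proof. by rewrite SJ -mulmxA mulmxV// mulmx1. Qed.

Lemma frame_row x : exists x', x = x' *m S.
Proof. by exists (x *m invmx S); rewrite mulmxKV. Qed.

Lemma conjM A B : (S *m A *m invmx S) *m (S *m B *m invmx S) = S *m (A *m B) *m invmx S.
Proof. by rewrite !mulmxA mulmxKV. Qed.

Lemma conj_inj A B : S *m A *m invmx S = S *m B *m invmx S -> A = B.
Proof.
move=> /(congr1 (fun C => invmx S *m C *m S)).
by rewrite !mulmxA mulVmx// !mul1mx !mulmxKV.
Qed.

Lemma frame_complex_jacobi x :
  complex_jacobi (stdJ R) Rm' x = S *m complex_jacobi J Rm (x *m S) *m invmx S.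
Proof. by rewrite /complex_jacobi -{2}frame_JV conjM frame_J. Qed.

Lemma frame_deficit kap x y : deficit 1%:M (stdJ R) Rm' kap x y =
  S *m deficit g J Rm kap (x *m S) (y *m S) *m invmx S.
Proof.
have W u v : wedge_mx 1%:M u v = S *m wedge_mx g (u *m S) (v *m S) *m invmx S.
  rewrite /wedge_mx mul1mx !trmx_mul mulmxA mulmxBr mulmxBl !mulmxA Sg !mul1mx.
  by rewrite -!mulmxA mulmxV// !mulmx1.
by rewrite /deficit !W !frame_J mulmxBr mulmxBl -scalemxAr -scalemxAl mulmxDr mulmxDl.
Qed.

Lemma frame_hol x :
  bilin 1%:M (x *m stdJ R *m Rm' x (x *m stdJ R)) x =
  bilin g (x *m S *m J *m Rm (x *m S) (x *m S *m J)) (x *m S).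
Proof.
by rewrite -(frame_bilin Sg) /Rm' !mulmxA mulmxKV// frame_J.
Qed.

(** Each clause is built from sums, products, traces and the metric. Conjugation by [S], called [c]
    below, is a trace-preserving algebra isomorphism and transports them. *)
Lemma exceptional_frame kap : exceptional 1%:M (stdJ R) Rm' kap -> exceptional g J Rm kap.
Proof.
move=> ex; pose c A := S *m A *m invmx S.
have cM A B : c A *m c B = c (A *m B) by exact: conjM.
have cB A B : c (A - B) = c A - c B by rewrite /c mulmxBr mulmxBl.
have cN A : c (- A) = - c A by rewrite /c mulmxN mulNmx.
have cZ (s : R) A : c (s *: A) = s *: c A by rewrite /c -scalemxAr -scalemxAl.
have c0 : c 0 = 0 by rewrite /c mulmx0 mul0mx.
have cI A B : c A = c B -> A = B by exact: conj_inj.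
have cS (s : R) : c s%:M = s%:M by rewrite /c scalar_mxC -mulmxA mulmxV// mulmx1.
have cJ : c J = stdJ R by exact: frame_JV.
have ctr A : \tr (c A) = \tr A by rewrite /c mxtrace_mulC mulmxA mulVmx// mul1mx.
have cD x y : c (deficit g J Rm kap (x *m S) (y *m S)) = deficit 1%:M (stdJ R) Rm' kap x y.
  by rewrite frame_deficit.
have cR x y : c (Rm (x *m S) (y *m S)) = Rm' x y by [].
have cb A x y : bilin (A *m g) (x *m S) (y *m S) = bilin (c A *m 1%:M) x y.
  by rewrite bilinMM mulmx1 /c (frame_inv Sg) !mulmxA.
split.
- move=> x y X; have [x' ->] := frame_row x; have [y' ->] := frame_row y.
  move=> sX cX; apply: cI; rewrite cB cZ cB -!cM cJ cR cb cJ.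
  apply: (ex_anti ex); rewrite -?cJ ?cM -?cN ?cX//.
  rewrite mulmx1 mul1mx {2}/c (frame_inv Sg) !trmx_mul trmxK (herm_sym hJ).
  by rewrite /c (frame_inv Sg) !mulmxA -mulmxDl -!(mulmxA S) -mulmxDr sX mulmx0 mul0mx.
- have [z [w zw]] := ex_neq0 ex; exists (z *m S), (w *m S).
  by apply: contraNneq zw; rewrite -cD => ->; rewrite c0.
- move=> x y z w; have [x' ->] := frame_row x; have [y' ->] := frame_row y.
  have [z' ->] := frame_row z; have [w' ->] := frame_row w.
  by apply: cI; rewrite -!cM !cD (ex_comm ex).
- move=> z w; have [z' ->] := frame_row z; have [w' ->] := frame_row w => M.
  apply: cI; rewrite cS -ctr -cM /M cD; exact: (ex_sqr ex).
- move=> z w; have [z' ->] := frame_row z; have [w' ->] := frame_row w => M.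
  rewrite -ctr -cM /M cD => /(ex_sqr0 ex); rewrite -cD => M0.
  by apply: cI; rewrite M0 c0.
- move=> x y z w; have [x' ->] := frame_row x; have [y' ->] := frame_row y.
  have [z' ->] := frame_row z; have [w' ->] := frame_row w => M.
  apply: cI; rewrite !cZ -ctr -cM cb /M !cD; exact: (ex_rank1 ex).
- move=> z w; have [z' ->] := frame_row z; have [w' ->] := frame_row w => M cMR.
  apply: cI; rewrite c0 /M cD; apply: (ex_center ex) => x y.
  by rewrite -cD -cR !cM cMR.
Qed.

End Frame.

Lemma complex_jacobi_two_valued x : two_valued (complex_jacobi J Rm x).
Proof.
have [e1 e1E] := unit_vector; have [S [Sg SJ _]] := unitary_frame hJ e1E.
have uS := frame_unit Sg.
have [p [q [t [u [a [b [c [d [e RE]]]]]]]]] := std_curvP (kaehler_curvature_frame hJ Sg SJ kR).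
have [x' ->] := frame_row Sg x.
have [_ _] := two_valued_conj (complex_jacobi J Rm (x' *m S)) uS; apply.
rewrite -(frame_complex_jacobi Sg SJ) /complex_jacobi RE.
exact: std_two_valued.
Qed.

(** Homogeneity, of degree 2 for the mean and 4 for the deviation, extends the hypothesis to all
    vectors, as the comparison in [std_osserman] requires. The constant is [- al] because
    [p + t + u] is both [- 2 * al] and [2 * kap]. *)
Lemma pointwise_osserman al ro :
  (forall x, bilin g x x = 1 -> mean (complex_jacobi J Rm x) = al /\
     deviation (complex_jacobi J Rm x) = ro) ->
  (ro != al ^+ 2 \/ al = 0 -> forall x, bilin g x x = 1 ->
     bilin g (x *m J *m Rm x (x *m J)) x = 4 / 3 * al) /\
  (ro = al ^+ 2 -> al != 0 -> exceptional g J Rm (- al)).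
Proof.
move=> H.
have [e1 e1E] := unit_vector; have [S [Sg SJ _]] := unitary_frame hJ e1E.
have uS := frame_unit Sg.
have [p [q [t [u [a [b [c [d [e RE]]]]]]]]] := std_curvP (kaehler_curvature_frame hJ Sg SJ kR).
have RE' : (fun x y => S *m Rm (x *m S) (y *m S) *m invmx S) = std_curv p q t u a b c d e.
  by apply/funext => x; apply/funext => y; exact: RE.
have Hm x : mean (complex_jacobi (stdJ R) (std_curv p q t u a b c d e) x) = al * bilin 1%:M x x.
  rewrite -RE' (frame_complex_jacobi Sg SJ) -(frame_bilin Sg) -[bilin _ _ _]expr1.
  have [-> _ _] := two_valued_conj (complex_jacobi J Rm (x *m S)) uS.
  apply: (@homogeneous_unit (fun x => mean (complex_jacobi J Rm x)) al 0); last by move=> y /H[].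
  by move=> s y; rewrite complex_jacobiZ meanZ.
have Hd x : deviation (complex_jacobi (stdJ R) (std_curv p q t u a b c d e) x) =
    ro * bilin 1%:M x x ^+ 2.
  rewrite -RE' (frame_complex_jacobi Sg SJ) -(frame_bilin Sg).
  have [_ -> _] := two_valued_conj (complex_jacobi J Rm (x *m S)) uS.
  apply: (@homogeneous_unit (fun x => deviation (complex_jacobi J Rm x)) ro 1); last by move=> y /H[].
  by move=> s y; rewrite complex_jacobiZ deviationZ.
have [[qE cE dE trE] [F0 F1 F2 [F3 F4 F5]]] := std_osserman Hm Hd.
split=> [roal x|roal al0].
  have [x' ->] := frame_row Sg x.
  rewrite (frame_bilin Sg) -(frame_hol Sg SJ) => x1.
  have [||k1 k2 [a0 b0 e0]] := @sqr_scalar_sym3 R _ t u a b e ro (- al) _ F0 F1 F2 F3 F4 F5.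
  - lra.
  - by case: roal => [?|->]; [left; rewrite sqrrN|right; rewrite oppr0].
  (* Here B is scalar with trace [- al]; then [p = 2 * k + t + u] is four thirds of [- al], and the
     holomorphic sectional curvature is [- p]. *)
  have tE : t = - al / 3 by lra.
  have uE : u = - al / 3 by lra.
  have pE : p = - 4 / 3 * al by lra.
  rewrite RE std_hol qE cE dE a0 b0 e0 pE tE uE.
  have -> : 4 / 3 * al = 4 / 3 * al * bilin 1%:M x' x' ^+ 2 by rewrite x1 expr1n mulr1.
  by rewrite std_bilin; field.
apply: (exceptional_frame Sg SJ); rewrite RE' qE cE dE.
apply: std_exceptional; rewrite ?oppr_eq0 ?sqrrN -?roal //; lra.
Qed.

(** On the complex line of [x] the operator is [c], the curvature of that line; on the orthogonal
    complement the two Jacobi operators together contribute c/4 + c/4. *)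
Lemma pointwise_chsc c : (forall x, bilin g x x = 1 ->
    bilin g (x *m J *m Rm x (x *m J)) x = c) ->
  forall x, bilin g x x = 1 -> exists2 S : 'M[R]_4, S \in unitmx &
    complex_jacobi J Rm x = invmx S *m
      (\matrix_(i, j) ((i == j)%:R * (if (i < 2)%N then c else c / 2))) *m S.
Proof.
move=> H x x1; have [S [Sg SJ S0]] := unitary_frame hJ x1.
have uS := frame_unit Sg.
have [p [q [t [u [a [b [cc [d [e RE]]]]]]]]] := std_curvP (kaehler_curvature_frame hJ Sg SJ kR).
have HH y : bilin 1%:M (y *m stdJ R *m (std_curv p q t u a b cc d e y (y *m stdJ R))) y =
   c * bilin 1%:M y y ^+ 2.
  rewrite -RE (frame_hol Sg SJ) -(frame_bilin Sg).
  by apply: (@homogeneous_unit (fun x => bilin g (x *m J *m Rm x (x *m J)) x) c 1) => // s z; exact: holZ.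
exists S => //; set D := \matrix_(i, j) _.
suff key : S *m complex_jacobi J Rm x *m invmx S = D.
  by rewrite -key !mulmxA mulVmx// mul1mx mulmxKV.
have Ex : x = rv4 1 0 0 0 *m S.
  rewrite -S0 rowE; congr (_ *m _).
  by apply/rowP; apply: ord4P; rewrite !mxE.
have -> : S *m complex_jacobi J Rm x *m invmx S = complex_jacobi (stdJ R) (fun u v =>
    S *m Rm (u *m S) (v *m S) *m invmx S) (rv4 1 0 0 0).
  by rewrite (frame_complex_jacobi Sg SJ) -Ex.
rewrite /complex_jacobi RE.
have {}HH (x0 x1 x2 x3 : R) := HH (rv4 x0 x1 x2 x3).
have T0 := HH 1 0 0 0; have T1 := HH 0 0 1 0; have T2 := HH 0 1 1 0.
have T3 := HH 0 1 (-1) 0; have T4 := HH 0 2 1 0; have T5 := HH 1 0 1 0.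
have T6 := HH 1 0 (-1) 0; have T7 := HH 2 0 1 0; have T8 := HH 1 1 1 0.
move: T0 T1 T2 T3 T4 T5 T6 T7 T8; rewrite !std_hol !std_bilin !mxE /=.
move=> T0 T1 T2 T3 T4 T5 T6 T7 T8.
have [pE tE uE [aE bE]] : [/\ p = - c, t = - c / 4, u = - c / 4 & a = 0 /\ b = 0].
  by split; [lra..|split; lra].
rewrite /std_curv; have [-> -> -> ->] := phi_stdJ (rv4 1 0 0 0 : 'rV[R]_4).
rewrite pE tE uE aE bE [X in X *m _](_ : _ = skew4 (- c) (- c / 2) 0 0); last first.
  by congr skew4; rewrite !mxE /=; field.
by rewrite /D; mx4; rewrite !mxE !big_ord_recl !big_ord0 !mxE /=; field.
Qed.

End ArbitraryFrame.

(** * Covariant derivatives in a chart *)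

Lemma trmx_linear (R : pzRingType) m n :
  [/\ forall A B : 'M[R]_(m, n), (A + B)^T = A^T + B^T,
      forall A B : 'M[R]_(m, n), (A - B)^T = A^T - B^T &
      forall A : 'M[R]_(m, n), (- A)^T = - A^T].
Proof. by split=> *; apply/matrixP => i j; rewrite !mxE. Qed.

(** After expansion each monomial is abstracted as an opaque matrix, so that only a linear identity
    between entries is left for [ring]. *)
Ltac mx_noncomm_ring :=
  rewrite ?(mulmxDl, mulmxDr, mulmxBl, mulmxBr, mulmxN, mulNmx, mulmxA);
  repeat match goal with |- context [@mulmx ?K ?m ?n ?p ?A ?B] =>
    move: (@mulmx K m n p A B) => ? end;
  apply/matrixP => ? ?; rewrite ?mxE; ring.

Section MatrixConnection.
Variables (R : realType) (n : nat) (O : set 'rV[R]_n).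
Hypothesis openO : open O.
Variable G : 'rV[R]_n -> 'rV[R]_n -> 'M[R]_n.
Hypothesis SG : forall u, msmooth O (G u).
Implicit Types (u v w x y : 'rV[R]_n) (A B : 'rV[R]_n -> 'M[R]_n) (f : 'rV[R]_n -> R).

(* Covariant derivatives and curvature of the connection acting on row vectors
   by [z |-> 'D_u z + z *m G u]. *)
Definition cov A u y := 'D_u A y + A y *m G u y - G u y *m A y.

Definition riem u v y :=
  'D_u (G v) y - 'D_v (G u) y + (G v y *m G u y - G u y *m G v y).

Lemma msmooth_riem u v : msmooth O (riem u v).
Proof.
apply: (msmoothD openO); apply: (msmoothB openO).
- exact: (msmooth_derive openO).
- exact: (msmooth_derive openO).
- exact: (msmoothM openO).
- exact: (msmoothM openO).
Qed.

Lemma msmooth_cov A u : msmooth O A -> msmooth O (cov A u).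
Proof.
move=> SA; apply: (msmoothB openO); last exact: (msmoothM openO).
apply: (msmoothD openO); last exact: (msmoothM openO).
exact: (msmooth_derive openO).
Qed.

Lemma eq_cov A B u x : {in O, A =1 B} -> O x -> cov A u x = cov B u x.
Proof.
by move=> AB Ox; rewrite /cov (derive_eq_on openO u AB Ox) AB ?inE.
Qed.

Section AtPoint.
Variable x : 'rV[R]_n.
Hypothesis Ox : O x.

Lemma covM A B u : msmooth O A -> msmooth O B ->
  cov (fun y => A y *m B y) u x = cov A u x *m B x + A x *m cov B u x.
Proof.
move=> SA SB; rewrite /cov (derive_msmoothM openO u Ox SA SB).
have key (a b c d e : 'M[R]_n) : a *m d + c *m b + c *m d *m e - e *m (c *m d) =
    (a + c *m e - e *m c) *m d + c *m (b + d *m e - e *m d) by mx_noncomm_ring.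
exact: key.
Qed.

Lemma covD A B u : msmooth O A -> msmooth O B ->
  cov (fun y => A y + B y) u x = cov A u x + cov B u x.
Proof.
move=> SA SB; rewrite /cov (derive_msmoothD u Ox SA SB).
have key (a b c d e : 'M[R]_n) : a + b + (c + d) *m e - e *m (c + d) =
    a + c *m e - e *m c + (b + d *m e - e *m d) by mx_noncomm_ring.
exact: key.
Qed.

Lemma covB A B u : msmooth O A -> msmooth O B ->
  cov (fun y => A y - B y) u x = cov A u x - cov B u x.
Proof.
move=> SA SB; rewrite /cov (derive_msmoothB u Ox SA SB).
have key (a b c d e : 'M[R]_n) : a - b + (c - d) *m e - e *m (c - d) =
    a + c *m e - e *m c - (b + d *m e - e *m d) by mx_noncomm_ring.
exact: key.
Qed.

Lemma covZ f A u : dsmooth O f -> msmooth O A ->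
  cov (fun y => f y *: A y) u x = 'D_u f x *: A x + f x *: cov A u x.
Proof.
move=> Sf SA; rewrite /cov (derive_msmoothZ openO u Ox Sf SA).
by rewrite -scalemxAl -scalemxAr !scalerBr !scalerDr !addrA.
Qed.

Lemma cov_cstZ (c : R) A u : msmooth O A -> cov (fun y => c *: A y) u x = c *: cov A u x.
Proof.
move=> SA; rewrite covZ//; last exact: dsmooth_cst.
by rewrite derive_cst scale0r add0r.
Qed.

Lemma cov_scalar f u : dsmooth O f -> cov (fun y => (f y)%:M) u x = ('D_u f x)%:M.
Proof.
move=> Sf; have S1 := @msmooth_cst R _ O n n 1%:M.
have E : (fun y => (f y)%:M) = (fun y => f y *: (1%:M : 'M[R]_n)).
  by apply/funext => y; rewrite scalemx1.
rewrite E covZ// /cov derive_cst mulmx1 mul1mx add0r subrr scaler0 addr0.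
by rewrite scalemx1.
Qed.

(** The slots hold constant coordinate fields and only matrix values are differentiated covariantly:
    this is d^nabla R = 0. Second partial derivatives commute, and the rest cancels as a
    noncommutative polynomial. *)
Lemma second_bianchi u v w :
  cov (riem v w) u x + cov (riem w u) v x + cov (riem u v) w x = 0.
Proof.
have SD a b : msmooth O ('D_a (G b)) by exact: (msmooth_derive openO).
have SM a b : msmooth O (fun y => G a y *m G b y) by exact: (msmoothM openO).
have E a b c : 'D_a (riem b c) x =
    'D_a ('D_b (G c)) x - 'D_a ('D_c (G b)) x +
    ('D_a (G c) x *m G b x + G c x *m 'D_a (G b) x
     - ('D_a (G b) x *m G c x + G b x *m 'D_a (G c) x)).
  rewrite /riem (derive_msmoothD _ Ox); first last.
  - exact: (msmoothB openO).
  - exact: (msmoothB openO).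
  rewrite (derive_msmoothB _ Ox)// (derive_msmoothB _ Ox)//.
  by rewrite !(derive_msmoothM openO _ Ox).
have key (gu gv gw dugv dugw dvgu dvgw dwgu dwgv p p' q q' r r' : 'M[R]_n) :
    p = p' -> q = q' -> r = r' ->
    (p - q + (dugw *m gv + gw *m dugv - (dugv *m gw + gv *m dugw)) +
      (dvgw - dwgv + (gw *m gv - gv *m gw)) *m gu -
      gu *m (dvgw - dwgv + (gw *m gv - gv *m gw))) +
    (r - p' + (dvgu *m gw + gu *m dvgw - (dvgw *m gu + gw *m dvgu)) +
      (dwgu - dugw + (gu *m gw - gw *m gu)) *m gv -
      gv *m (dwgu - dugw + (gu *m gw - gw *m gu))) +
    (q' - r' + (dwgv *m gu + gv *m dwgu - (dwgu *m gv + gu *m dwgv)) +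
      (dugv - dvgu + (gv *m gu - gu *m gv)) *m gw -
      gw *m (dugv - dvgu + (gv *m gu - gu *m gv))) = 0.
  by move=> -> -> ->; mx_noncomm_ring.
rewrite /cov (E u) (E v) (E w) /riem; apply: key.
- by apply: (derive_msmooth_comm openO).
- by apply: (derive_msmooth_comm openO).
- by apply: (derive_msmooth_comm openO).
Qed.

Lemma ricci_identity A u v : msmooth O A ->
  cov (cov A v) u x - cov (cov A u) v x = A x *m riem u v x - riem u v x *m A x.
Proof.
move=> SA.
have SDA a : msmooth O ('D_a A) by exact: (msmooth_derive openO).
have SAG a : msmooth O (fun y => A y *m G a y) by exact: (msmoothM openO).
have SGA a : msmooth O (fun y => G a y *m A y) by exact: (msmoothM openO).
have E a b : 'D_a (cov A b) x = 'D_a ('D_b A) x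
    + ('D_a A x *m G b x + A x *m 'D_a (G b) x)
    - ('D_a (G b) x *m A x + G b x *m 'D_a A x).
  rewrite /cov (derive_msmoothB _ Ox)//; last exact: (msmoothD openO).
  by rewrite (derive_msmoothD _ Ox)// !(derive_msmoothM openO _ Ox).
have key (a gu gv dugv dvgu dua dva p p' : 'M[R]_n) : p = p' ->
    (p + (dua *m gv + a *m dugv) - (dugv *m a + gv *m dua) +
      (dva + a *m gv - gv *m a) *m gu - gu *m (dva + a *m gv - gv *m a)) -
    (p' + (dva *m gu + a *m dvgu) - (dvgu *m a + gu *m dva) +
      (dua + a *m gu - gu *m a) *m gv - gv *m (dua + a *m gu - gu *m a)) =
    a *m (dugv - dvgu + (gv *m gu - gu *m gv)) -
    (dugv - dvgu + (gv *m gu - gu *m gv)) *m a by move=> ->; mx_noncomm_ring.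
have covE B a : cov B a x = 'D_a B x + B x *m G a x - G a x *m B x by [].
rewrite (covE (cov A v)) (covE (cov A u)) (E u v) (E v u) !(covE A) /riem; apply: key.
by apply: (derive_msmooth_comm openO).
Qed.

End AtPoint.

Section Metric.
Variables (g : 'rV[R]_n -> 'M[R]_n).
Hypothesis Sg : msmooth O g.
Hypothesis Dg : forall u x, O x -> 'D_u g x = G u x *m g x + g x *m (G u x)^T.
Hypothesis torsion : forall u v x, O x -> v *m G u x = u *m G v x.
Variable x : 'rV[R]_n.
Hypothesis Ox : O x.

(** Differentiate the compatibility equation [Dg] once more and antisymmetrize; Schwarz's theorem
    removes the second derivatives of [g]. *)
Lemma riem_skew u v : riem u v x *m g x + g x *m (riem u v x)^T = 0.
Proof.
have E a b : 'D_a ('D_b g) x =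
    'D_a (G b) x *m g x + G b x *m (G a x *m g x + g x *m (G a x)^T)
    + ((G a x *m g x + g x *m (G a x)^T) *m (G b x)^T + g x *m ('D_a (G b) x)^T).
  rewrite (@derive_eq_on _ _ O openO _ _ (fun y => G b y *m g y + g y *m (G b y)^T)) //; last first.
    by move=> y /set_mem Oy; exact: Dg.
  have SgT : msmooth O (fun y => (G b y)^T) by exact: (msmoothT openO).
  rewrite (derive_msmoothD _ Ox); [|exact: (msmoothM openO)..].
  by rewrite !(derive_msmoothM openO _ Ox)// (derive_msmoothT openO _ Ox)// Dg.
have key (dugv dvgu gu gv h : 'M[R]_n) :
    dugv *m h + gv *m (gu *m h + h *m gu^T)
      + ((gu *m h + h *m gu^T) *m gv^T + h *m dugv^T) =
    dvgu *m h + gu *m (gv *m h + h *m gv^T)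
      + ((gv *m h + h *m gv^T) *m gu^T + h *m dvgu^T) ->
    (dugv - dvgu + (gv *m gu - gu *m gv)) *m h
      + h *m (dugv - dvgu + (gv *m gu - gu *m gv))^T = 0.
  have [trD trB trN] := trmx_linear R n n.
  move/eqP; rewrite -subr_eq0 => /eqP H; rewrite -[RHS]H !(trD, trN) !trmx_mul.
  mx_noncomm_ring.
rewrite /riem; apply: key; apply: etrans (esym (E u v)) (etrans _ (E v u)).
by apply: (derive_msmooth_comm openO).
Qed.

(** The derivative of the symmetry [torsion] pairs off the terms with derivatives, and [torsion]
    itself pairs off the products. *)
Lemma first_bianchi u v w :
  w *m riem u v x + u *m riem v w x + v *m riem w u x = 0.
Proof.
have E (a b c : 'rV[R]_n) : c *m 'D_a (G b) x = b *m 'D_a (G c) x.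
  have S1 d := @msmooth_cst R _ O 1 n d.
  have D (d e : 'rV[R]_n) : d *m 'D_a (G e) x = 'D_a (fun y => d *m G e y) x.
    by rewrite (derive_msmoothM openO a Ox (S1 d) (SG e)) derive_cst mul0mx add0r.
  rewrite !D; apply: (derive_eq_on openO) => // y /set_mem Oy.
  exact: torsion.
have key (dugv dugw dvgu dvgw dwgu dwgv gu gv gw : 'M[R]_n) :
    w *m dugv = v *m dugw -> w *m dvgu = u *m dvgw -> v *m dwgu = u *m dwgv ->
    w *m gv = v *m gw -> w *m gu = u *m gw -> v *m gu = u *m gv ->
    w *m (dugv - dvgu + (gv *m gu - gu *m gv)) +
    u *m (dvgw - dwgv + (gw *m gv - gv *m gw)) +
    v *m (dwgu - dugw + (gu *m gw - gw *m gu)) = 0.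
  move=> e1 e2 e3 e4 e5 e6; rewrite !mulmxDr !mulmxN !mulmxA e1 e2 e3 e4 e5 e6.
  mx_noncomm_ring.
rewrite /riem; apply: key; (try exact: E); exact: torsion.
Qed.

Lemma cov_skew A u : msmooth O A ->
  (forall y, O y -> A y *m g y + g y *m (A y)^T = 0) ->
  cov A u x *m g x + g x *m (cov A u x)^T = 0.
Proof.
move=> SA skA.
have SAT : msmooth O (fun y => (A y)^T) by exact: (msmoothT openO).
have := @derive_eq_on _ _ O openO _ (fun y => A y *m g y + g y *m (A y)^T) (fun=> 0) x u.
move=> /(_ _ Ox) H.
have {H} : 'D_u (fun y => A y *m g y + g y *m (A y)^T) x = 0.
  by rewrite H ?derive_cst// => y /set_mem; exact: skA.
rewrite (derive_msmoothD _ Ox); [|exact: (msmoothM openO)..].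
rewrite !(derive_msmoothM openO _ Ox)// (derive_msmoothT openO _ Ox)// Dg// /cov => H.
have Ag : g x *m (A x)^T = - (A x *m g x).
  by apply/eqP; rewrite -addr_eq0 addrC skA.
have key (da a h gu : 'M[R]_n) : h *m a^T = - (a *m h) ->
    da *m h + a *m (gu *m h + h *m gu^T) +
      ((gu *m h + h *m gu^T) *m a^T + h *m da^T) = 0 ->
    (da + a *m gu - gu *m a) *m h + h *m (da + a *m gu - gu *m a)^T = 0.
  move=> ha {}H; rewrite -[RHS]H; have [trD trB trN] := trmx_linear R n n.
  rewrite !(trD, trN) !trmx_mul.
  rewrite !mulmxBr !mulmxDr !mulmxBl !mulmxDl !mulmxA ha -[gu *m h *m a^T]mulmxA ha.
  mx_noncomm_ring.
exact: key.
Qed.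

End Metric.
End MatrixConnection.

(* A nondegenerate 2-form is not annihilated by a nonzero 1-form: plug in
   [v] orthogonal to [u] and [u *m K], and [w := v *m K]. *)
Lemma wedge_nondegenerate (R : realType) n (g J K : 'M[R]_n.+3) (c : R)
    (T : 'rV[R]_n.+3 -> 'M[R]_n.+3) : compatible_acs g J ->
  K *m g + g *m K^T = 0 -> K *m K = c%:M -> c != 0 ->
  (forall u v w, bilin (K *m g) v w *: T u + bilin (K *m g) w u *: T v +
     bilin (K *m g) u v *: T w = 0) ->
  forall u, T u = 0.
Proof.
move=> hJ skK sqK c0 H u.
have [v v0 [vu vuK]] := ortho_two (g *m u^T) (g *m (u *m K)^T).
have E (A : 'M[R]_n.+3) x y : bilin (A *m g) x y = bilin g (x *m A) y.
  by rewrite /bilin !mulmxA.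
have skE x y : bilin (K *m g) x y = - bilin g x (y *m K).
  have KE : K *m g = - (g *m K^T) by apply/eqP; rewrite -addr_eq0 skK.
  by rewrite /bilin KE trmx_mul mulmxN mulNmx mxE !mulmxA.
have e1 : bilin (K *m g) (v *m K) u = 0.
  rewrite E -mulmxA sqK mul_mx_scalar bilinZl.
  by rewrite [bilin g v u](_ : _ = 0) ?mulr0// /bilin -mulmxA vu mxE.
have e2 : bilin (K *m g) u v = 0.
  rewrite E (herm_bilinC hJ).
  by rewrite /bilin -mulmxA vuK mxE.
have := H u v (v *m K); rewrite e1 e2 !scale0r !addr0 => /eqP.
rewrite scaler_eq0 skE -mulmxA sqK mul_mx_scalar bilinZr oppr_eq0 mulf_eq0 (negPf c0).
by rewrite gt_eqF ?(herm_pos hJ)//= => /eqP.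
Qed.

(** * Exclusion of the exceptional case on an open set *)

Section NoExceptionalChart.
Variables (R : realType) (O : set 'rV[R]_4).
Hypothesis openO : open O.
Variable G : 'rV[R]_4 -> 'rV[R]_4 -> 'M[R]_4.
Hypothesis SG : forall u, msmooth O (G u).
Variables (g J : 'rV[R]_4 -> 'M[R]_4) (kap : R).
Hypotheses (Sg : msmooth O g) (SJ : msmooth O J).
Hypothesis Dg : forall u x, O x -> 'D_u g x = G u x *m g x + g x *m (G u x)^T.
Hypothesis torsion : forall u v x, O x -> v *m G u x = u *m G v x.
Hypothesis hJ : forall x, O x -> compatible_acs (g x) (J x).
Let Rm x u v := riem G u v x.
Hypothesis comJ : forall u v x, O x -> Rm x u v *m J x = J x *m Rm x u v.
Hypothesis kap0 : kap != 0.
Hypothesis ex : forall x, O x -> exceptional (g x) (J x) (Rm x) kap.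
Implicit Types x y u v w z : 'rV[R]_4.

Let SR u v : msmooth O (riem G u v).
Proof. exact: msmooth_riem. Qed.

Lemma cov_wedge (A B : 'rV[R]_4 -> 'rV[R]_4) u x : msmooth O A -> msmooth O B -> O x ->
  cov G (fun y => wedge_mx (g y) (A y) (B y)) u x =
  wedge_mx (g x) ('D_u A x + A x *m G u x) (B x) +
  wedge_mx (g x) (A x) ('D_u B x + B x *m G u x).
Proof.
move=> SA SB Ox; rewrite /wedge_mx /cov.
have SAT : msmooth O (fun y => (A y)^T) by exact: msmoothT.
have SBT : msmooth O (fun y => (B y)^T) by exact: msmoothT.
have SAB : msmooth O (fun y => (A y)^T *m B y) by exact: msmoothM.
have SBA : msmooth O (fun y => (B y)^T *m A y) by exact: msmoothM.
rewrite (derive_msmoothM openO u Ox Sg (msmoothB openO SBA SAB)) Dg//.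
rewrite (derive_msmoothB u Ox SBA SAB).
rewrite (derive_msmoothM openO u Ox SAT SB) (derive_msmoothM openO u Ox SBT SA).
rewrite (derive_msmoothT openO u Ox SA) (derive_msmoothT openO u Ox SB).
have key (a b da db : 'rV[R]_4) (h gu : 'M[R]_4) :
    (gu *m h + h *m gu^T) *m (b^T *m a - a^T *m b) +
      h *m (db^T *m a + b^T *m da - (da^T *m b + a^T *m db)) +
      h *m (b^T *m a - a^T *m b) *m gu - gu *m (h *m (b^T *m a - a^T *m b)) =
    h *m (b^T *m (da + a *m gu) - (da + a *m gu)^T *m b) +
    h *m ((db + b *m gu)^T *m a - a^T *m (db + b *m gu)).
  have [trD _ trN] := trmx_linear R 1 4.
  by rewrite !trD !trmx_mul; mx_noncomm_ring.
exact: key.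
Qed.

(** nabla J is skew, and anticommutes with [J] by differentiating J^2 = -1, so [ex_anti] evaluates
    [R, nabla J]; this is minus [nabla R, J], whose cyclic sum vanishes by the second Bianchi
    identity. *)
Lemma cov_J0 u x : O x -> cov G J u x = 0.
Proof.
move=> Ox; have hx := hJ Ox.
have skJ : cov G J u x *m g x + g x *m (cov G J u x)^T = 0.
  by apply: (cov_skew openO) => // y Oy; exact: herm_skew (hJ Oy).
have anti v : cov G J v x *m J x = - (J x *m cov G J v x).
  have := covM openO G Ox v SJ SJ.
  have -> : cov G (fun y => J y *m J y) v x = cov G (fun y => (-1)%:M) v x.
    apply: (eq_cov openO) => // y /set_mem Oy.
    by rewrite (herm_sqr (hJ Oy)) raddfN.
  rewrite (cov_scalar openO)//; last exact: dsmooth_cst.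
  rewrite derive_cst raddf0 => /esym/eqP.
  by rewrite addr_eq0 => /eqP.
have commR a b v : cov G (riem G a b) v x *m J x - J x *m cov G (riem G a b) v x =
    - (Rm x a b *m cov G J v x - cov G J v x *m Rm x a b).
  have := covM openO G Ox v (SR a b) SJ.
  have -> : cov G (fun y => riem G a b y *m J y) v x =
      cov G (fun y => J y *m riem G a b y) v x.
    by apply: (eq_cov openO) => // y /set_mem Oy; exact: comJ.
  rewrite (covM openO G Ox v SJ (SR a b)) /Rm.
  move: (cov G (riem G a b) v x) (cov G J v x) (J x) (riem G a b x) => p q r s e.
  have -> : p *m r - r *m p = (p *m r + s *m q) - s *m q - r *m p by rewrite addrK.
  by rewrite -e; mx_noncomm_ring.
have [T TE] : exists T, forall v, T v = J x *m cov G J v x - cov G J v x *m J x.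
  by exists (fun v => J x *m cov G J v x - cov G J v x *m J x).
have T0 : T u = 0.
  apply: (@wedge_nondegenerate R 1 (g x) (J x) (J x) (-1) T hx).
  - exact: herm_skew.
  - by rewrite (herm_sqr hx) raddfN.
  - by rewrite oppr_eq0 oner_eq0.
  move=> a b c.
  have E p q r : (kap * bilin (J x *m g x) p q) *: T r =
     - (cov G (riem G p q) r x *m J x - J x *m cov G (riem G p q) r x).
    rewrite commR opprK TE -(ex_anti (ex Ox)) //.
    by apply: (cov_skew openO) => // y Oy; exact: herm_skew (hJ Oy).
  apply: (scalerI kap0); rewrite !scalerDr !scalerA !E scaler0.
  have := second_bianchi openO SG Ox a b c.
  move: (cov G _ a x) (cov G _ b x) (cov G _ c x) (J x) => p q r s e.
  transitivity (- ((p + q + r) *m s - s *m (p + q + r))); last first.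
    by rewrite e mul0mx mulmx0 subrr oppr0.
  mx_noncomm_ring.
(* By anticommutation the vanishing commutator is 2 J nabla J, and [J] is invertible. *)
move: T0; rewrite TE anti opprK -mulr2n => /eqP; rewrite -scaler_nat scaler_eq0 pnatr_eq0 /=.
move=> /eqP/(congr1 (mulmx (J x))); rewrite mulmxA (herm_sqr hx) mulmx0 mulNmx mul1mx.
by move/eqP; rewrite oppr_eq0 => /eqP.
Qed.

Let N u v y := deficit (g y) (J y) (Rm y) kap u v.

(** Differentiating the wedge terms only changes a slot [a] into [a *m G c x], which is symmetric in
    [a] and [c] by [torsion], so the cyclic sum cancels in pairs. For the slots containing [J] this
    uses nabla J = 0. *)
Lemma deficit_bianchi u v w x : O x ->
  cov G (N v w) u x + cov G (N w u) v x + cov G (N u v) w x = 0.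
Proof.
move=> Ox.
have S1 (a : 'rV[R]_4) := @msmooth_cst R _ O 1 4 a.
have SaJ (a : 'rV[R]_4) : msmooth O (fun y => a *m J y) by exact: (msmoothM openO (S1 a) SJ).
have Sw (A B : 'rV[R]_4 -> 'rV[R]_4) : msmooth O A -> msmooth O B ->
    msmooth O (fun y => wedge_mx (g y) (A y) (B y)).
  move=> SA SB; apply: (msmoothM openO) => //.
  by apply: (msmoothB openO); apply: (msmoothM openO (msmoothT openO _)).
have DC (a c : 'rV[R]_4) : 'D_c (fun=> a) x + a *m G c x = a *m G c x.
  by rewrite derive_cst add0r.
have DJ (a c : 'rV[R]_4) : 'D_c (fun y => a *m J y) x + a *m J x *m G c x = a *m G c x *m J x.
  rewrite (derive_msmoothM openO c Ox (S1 a) SJ) derive_cst mul0mx add0r.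
  have := cov_J0 c Ox; rewrite /cov => /eqP; rewrite subr_eq0 => /eqP e.
  by rewrite -!mulmxA -mulmxDr e.
have E (a b c : 'rV[R]_4) : cov G (N a b) c x =
    - kap *: (wedge_mx (g x) (a *m G c x) b + wedge_mx (g x) a (b *m G c x)
      + (wedge_mx (g x) (a *m G c x *m J x) (b *m J x)
         + wedge_mx (g x) (a *m J x) (b *m G c x *m J x)))
    - cov G (riem G a b) c x.
  have SW1 : msmooth O (fun y => wedge_mx (g y) a b) by exact: (Sw (fun=> a) (fun=> b)).
  have SW2 : msmooth O (fun y => wedge_mx (g y) (a *m J y) (b *m J y)).
    exact: (Sw (fun y => a *m J y) (fun y => b *m J y)).
  have SW := msmoothD openO SW1 SW2.
  rewrite /N /deficit (covB G Ox c (msmoothZ openO (dsmooth_cst O (- kap)) SW) (SR a b)).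
  rewrite (cov_cstZ openO G Ox (- kap) c SW) (covD G Ox c SW1 SW2).
  have CW (A B : 'rV[R]_4 -> 'rV[R]_4) (dA dB : 'rV[R]_4) : msmooth O A -> msmooth O B ->
      'D_c A x + A x *m G c x = dA -> 'D_c B x + B x *m G c x = dB ->
      cov G (fun y => wedge_mx (g y) (A y) (B y)) c x =
      wedge_mx (g x) dA (B x) + wedge_mx (g x) (A x) dB.
    by move=> SA SB <- <-; exact: cov_wedge.
  by rewrite (CW _ _ _ _ (S1 a) (S1 b) (DC a c) (DC b c))
    (CW _ _ _ _ (SaJ a) (SaJ b) (DJ a c) (DJ b c)).
rewrite !E (torsion v w Ox) (torsion u w Ox) (torsion u v Ox).
have cyc (h : 'M[R]_4) (p q r a b c : 'rV[R]_4) :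
    wedge_mx h p c + wedge_mx h b q + (wedge_mx h r a + wedge_mx h c p) +
    (wedge_mx h q b + wedge_mx h a r) = 0.
  by rewrite /wedge_mx; mx_noncomm_ring.
have key (k : R) (a1 a2 b1 b2 c1 c2 r1 r2 r3 : 'M[R]_4) : a1 + b1 + c1 = 0 ->
    a2 + b2 + c2 = 0 -> r1 + r2 + r3 = 0 ->
    k *: (a1 + a2) - r1 + (k *: (b1 + b2) - r2) + (k *: (c1 + c2) - r3) = 0.
  move=> e1 e2 e3.
  transitivity (k *: ((a1 + b1 + c1) + (a2 + b2 + c2)) - (r1 + r2 + r3)).
    by rewrite !scalerDr !opprD; apply/matrixP => i j; rewrite !mxE; ring.
  by rewrite e1 e2 e3 addr0 scaler0 subr0.
by apply: key; [exact: cyc|exact: cyc|exact: (second_bianchi openO SG Ox u v w)].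
Qed.

Lemma msmooth_deficit u v : msmooth O (N u v).
Proof.
have S1 (a : 'rV[R]_4) := @msmooth_cst R _ O 1 4 a.
have SW (A B : 'rV[R]_4 -> 'rV[R]_4) : msmooth O A -> msmooth O B ->
    msmooth O (fun y => wedge_mx (g y) (A y) (B y)).
  move=> SA SB; apply: (msmoothM openO) => //.
  by apply: (msmoothB openO); apply: (msmoothM openO (msmoothT openO _)).
have W1 := SW (fun=> u) (fun=> v) (S1 u) (S1 v).
have W2 := SW (fun y => u *m J y) (fun y => v *m J y)
  (msmoothM openO (S1 u) SJ) (msmoothM openO (S1 v) SJ).
exact: (msmoothB openO (msmoothZ openO (dsmooth_cst O (- kap)) (msmoothD openO W1 W2)) (SR u v)).
Qed.

Lemma deficit_skew u v x : O x -> N u v x *m g x + g x *m (N u v x)^T = 0.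
Proof.
move=> Ox; rewrite /N /deficit /wedge_mx.
have sR := riem_skew openO SG Sg Dg Ox u v.
have gT := herm_sym (hJ Ox).
have key (k : R) (h r : 'M[R]_4) (a b c d : 'rV[R]_4) : h^T = h ->
    r *m h + h *m r^T = 0 ->
    (k *: (h *m (b^T *m a - a^T *m b) + h *m (d^T *m c - c^T *m d)) - r) *m h +
    h *m (k *: (h *m (b^T *m a - a^T *m b) + h *m (d^T *m c - c^T *m d)) - r)^T = 0.
  move=> hT e; have [trD _ trN] := trmx_linear R 4 4.
  transitivity (- (r *m h + h *m r^T)); last by rewrite e oppr0.
  rewrite !(trD, trN) linearZ /= !(trD, trN) !trmx_mul !(trD, trN) !trmx_mul !trmxK hT.
  rewrite ?(mulmxDl, mulmxDr, mulmxN, mulNmx, mulmxA) -?(scalemxAl, scalemxAr).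
  by mx_noncomm_ring.
exact: key.
Qed.

Section ParallelDeficit.
Variables z w : 'rV[R]_4.
Let M := N z w.
Let f y := \tr (M y *m M y) / 4.
Let SM : msmooth O M := msmooth_deficit z w.

Let Sf : dsmooth O f.
Proof.
apply: (dsmoothM openO); last exact: dsmooth_cst.
by apply: (dsmooth_mxtrace openO); exact: (msmoothM openO).
Qed.

(** Where [f] is nonzero this says that [M] divided by the square root of |f| is parallel. Cleared
    of denominators it holds on all of [O], zeros of [M] included, and can be differentiated
    again. *)
Lemma deficit_recurrent u x : O x -> (2 * f x) *: cov G M u x = 'D_u f x *: M x.
Proof.
move=> Ox; have hx := hJ Ox; have ex_x := ex Ox.
have sqM y : O y -> M y *m M y = (f y)%:M by move=> /ex Ey; exact: ex_sqr Ey z w.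
have [f0|f0] := eqVneq (f x) 0.
  have M0 : M x = 0.
    apply: (ex_sqr0 ex_x); move/eqP: f0; rewrite /f mulf_eq0 invr_eq0 pnatr_eq0 orbF.
    by move/eqP.
  by rewrite f0 M0 mulr0 scale0r scaler0.
have commN a b c : M x *m cov G (N a b) c x - cov G (N a b) c x *m M x =
    N a b x *m cov G M c x - cov G M c x *m N a b x.
  have SN := msmooth_deficit a b.
  have := covM openO G Ox c SN SM.
  have -> : cov G (fun y => N a b y *m M y) c x = cov G (fun y => M y *m N a b y) c x.
    by apply: (eq_cov openO) => // y /set_mem Oy; exact: ex_comm (ex Oy) a b z w.
  rewrite (covM openO G Ox c SM SN).
  move: (cov G (N a b) c x) (cov G M c x) (M x) (N a b x) => p q r s e.
  have -> : r *m p = p *m r + s *m q - q *m s by rewrite -e addrC addKr.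
  by mx_noncomm_ring.
have [T TE] : exists T, forall c, T c = M x *m cov G M c x - cov G M c x *m M x.
  by exists (fun c => M x *m cov G M c x - cov G M c x *m M x).
have T0 : T u = 0.
  apply: (@wedge_nondegenerate R 1 (g x) (J x) (M x) (f x) T hx) => //.
  - exact: deficit_skew.
  - exact: sqM.
  move=> a b c.
  have E p q r : (- 2 * kap * bilin (M x *m g x) p q) *: T r =
      f x *: (M x *m cov G (N p q) r x - cov G (N p q) r x *m M x).
    have R1 : f x *: N p q x = (- 2 * kap * bilin (M x *m g x) p q) *: M x.
      exact: (ex_rank1 ex_x p q z w).
    rewrite commN scalerBr scalemxAl [in RHS]scalemxAr R1 -scalemxAl -scalemxAr.
    by rewrite TE scalerBr.
  have k0 : - 2 * kap != 0 by rewrite mulf_neq0// oppr_eq0 pnatr_eq0.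
  apply: (scalerI k0); rewrite !scalerDr !scalerA !E scaler0 -!scalerDr.
  rewrite [X in _ *: X](_ : _ = 0) ?scaler0//.
  have := deficit_bianchi a b c Ox.
  move: (cov G _ a x) (cov G _ b x) (cov G _ c x) (M x) => p q r s e.
  transitivity (s *m (p + q + r) - (p + q + r) *m s); last by rewrite e mul0mx mulmx0 subrr.
  by mx_noncomm_ring.
(* With this, differentiating M^2 = f gives 2 M nabla M = df; multiplication by [M] yields the
   claim. *)
have comm : M x *m cov G M u x = cov G M u x *m M x.
  by apply/eqP; rewrite -subr_eq0 -TE T0.
have := covM openO G Ox u SM SM.
rewrite (@eq_cov _ _ _ openO G _ (fun y => (f y)%:M)) //; last first.
  by move=> y /set_mem; exact: sqM.
rewrite (cov_scalar openO)// comm => /(congr1 (mulmx^~ (M x))).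
rewrite mul_scalar_mx mulmxDl -mulmxA sqM// mul_mx_scalar => ->.
by rewrite mulr_natl mulr2n scalerDl.
Qed.

(** Differentiate [deficit_recurrent] and antisymmetrize: the Hessian of [f] is symmetric, and the
    products of first derivatives cancel since each derivative of [M] is a multiple of [M]. So
    second covariant derivatives of [M] commute, and the Ricci identity applies. *)
Lemma deficit_commutes u v x : O x -> riem G u v x *m M x = M x *m riem G u v x.
Proof.
move=> Ox; have [f0|f0] := eqVneq (f x) 0.
  have -> : M x = 0; last by rewrite mulmx0 mul0mx.
  apply: (ex_sqr0 (ex Ox)); move/eqP: f0; rewrite /f mulf_eq0 invr_eq0 pnatr_eq0 orbF.
  by move/eqP.
have Sc a : msmooth O (cov G M a) by exact: msmooth_cov.
have S2f : dsmooth O (fun y => 2 * f y) by apply: (dsmoothM openO) => //; exact: dsmooth_cst.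
have D2f a : 'D_a (fun y => 2 * f y) x = 2 * 'D_a f x.
  rewrite -[LHS]/('D_a ((fun=> 2) * f) x) deriveMl //.
  exact: (dsmooth_derivable Sf Ox).
have E a b : (2 * 'D_b f x) *: cov G M a x + (2 * f x) *: cov G (cov G M a) b x =
    'D_b ('D_a f) x *: M x + 'D_a f x *: cov G M b x.
  rewrite -D2f -(covZ openO G Ox b S2f (Sc a)).
  rewrite -(covZ openO G Ox b (dsmooth_derive a Sf) SM).
  by apply: (eq_cov openO) => // y /set_mem; exact: deficit_recurrent.
have Eu := deficit_recurrent u Ox; have Ev := deficit_recurrent v Ox.
have ric := ricci_identity openO SG Ox u v SM.
have E1 := E v u; have E2 := E u v.
have fc : 'D_u ('D_v f) x = 'D_v ('D_u f) x by exact: (derive_comm openO).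
have key (p q c : R) (X A B P Q : 'M[R]_4) : c != 0 -> (2 * c) *: A = p *: X ->
    (2 * c) *: B = q *: X ->
    (2 * p) *: B + (2 * c) *: P = (2 * q) *: A + (2 * c) *: Q
      + q *: A - p *: B -> P = Q.
  move=> c0 eA eB e; have c20 : 2 * c != 0 by rewrite mulf_neq0// pnatr_eq0.
  have eAB : q *: A = p *: B.
    apply: (scalerI c20).
    by rewrite !scalerA ![2 * c * _]mulrC -(scalerA q) -(scalerA p) eA eB !scalerA mulrC.
  move: e; rewrite -addrA eAB subrr addr0 -(scalerA 2 q A) eAB scalerA.
  by move/addrI/(scalerI c20).
suff PQ : cov G (cov G M v) u x = cov G (cov G M u) v x.
  by apply/esym/eqP; rewrite -subr_eq0 -ric PQ subrr.
have key2 (t t' l a b : 'M[R]_4) : t = t' -> l = t' + b -> t + a = l + a - b.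
  by move=> -> ->; rewrite addrAC addrK.
have fcM := congr1 (fun r => r *: M x) fc.
exact: (key _ _ _ _ _ _ _ _ f0 Eu Ev (etrans E1 (key2 _ _ _ _ _ fcM E2))).
Qed.

End ParallelDeficit.

Lemma no_exceptional_chart x : ~ O x.
Proof.
move=> Ox; have [z [w]] := ex_neq0 (ex Ox); apply/negP; rewrite negbK; apply/eqP.
by apply: (ex_center (ex Ox)) => u v; exact: deficit_commutes.
Qed.
End NoExceptionalChart.

(** Row [j] is the covariant derivative of the [j]-th coordinate field along [u], so that the
    connection acts on rows from the right. *)
Definition conn (R : realType) n (g : 'rV[R]_n -> 'M[R]_n) (u y : 'rV[R]_n) : 'M[R]_n :=
  \matrix_(j, k) \sum_a u 0 a * christoffel g y k a j.

Lemma nabla_cstl (R : realType) n (g : 'rV[R]_n -> 'M[R]_n) u Y y :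
  nabla g (cst u) Y y = 'D_u Y y + Y y *m conn g u y.
Proof.
congr (_ + _); apply/rowP => k; rewrite !mxE exchange_big /=.
apply: eq_bigr => j _; rewrite mxE mulr_sumr; apply: eq_bigr => a _; ring.
Qed.

Lemma eq_mulmx_row (R : realType) n (A B : 'M[R]_n) :
  (forall z : 'rV[R]_n, z *m A = z *m B) -> A = B.
Proof. by move=> AB; apply/row_matrixP => k; rewrite !rowE. Qed.

(** * The Levi-Civita connection of a chart in matrix form *)

Section Chart.
Variables (R : realType) (n : nat) (H : almost_hermitian_manifold R n) (i : chart H).
Let O := phi i @` dom i.
Let g := metric i.
Let J := acs i.
Let openO : open O := @phi_open R n H i.
Implicit Types x y u v w z : 'rV[R]_n.

Lemma metric_msmooth : msmooth O g.
Proof. by apply: smooth_on_msmooth => //; exact: metric_smooth. Qed.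

Lemma acs_msmooth : msmooth O J.
Proof. by apply: smooth_on_msmooth => //; exact: acs_smooth. Qed.

Lemma chart_compatible x : O x -> compatible_acs (g x) (J x).
Proof.
move=> Ox; split.
- by apply/matrixP => a b; rewrite mxE; exact: metric_symE.
- by move=> v; exact: metric_pos.
- exact: acs_sqr.
- by apply: bilin_inj => u v; rewrite -bilinMM; exact: acs_isometry.
Qed.

Lemma conn_msmooth u : msmooth O (conn g u).
Proof.
have SV : msmooth O (fun y => invmx (g y)).
  by apply: msmoothV metric_msmooth => // x Ox; exact: metric_unit.
have Sd a b c : dsmooth O (fun y => dmetric g y a b c).
  exact: (msmooth_derive openO (delta_mx 0 a) metric_msmooth) b c.
move=> j k.
have S1 a : dsmooth O (fun y => u 0 a * christoffel g y k a j).
  apply: dsmoothM => //; first exact: dsmooth_cst.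
  apply: dsmoothM => //; first exact: dsmooth_cst.
  apply: dsmooth_sum => // l _; apply: dsmoothM => //.
  by apply: dsmoothB => //; apply: dsmoothD.
apply: (eq_dsmooth openO) (dsmooth_sum openO (index_enum 'I_n) (P := xpredT)
  (fun a _ => S1 a)) => y _.
by rewrite mxE.
Qed.

Lemma conn_linear a u v y : conn g (a *: u + v) y = a *: conn g u y + conn g v y.
Proof.
apply/matrixP => j k; rewrite !mxE mulr_sumr -big_split; apply: eq_bigr => b _ /=.
by rewrite !mxE; ring.
Qed.

Lemma conn_torsion u v x : O x -> v *m conn g u x = u *m conn g v x.
Proof.
move=> Ox; apply/rowP => k; rewrite !mxE.
under eq_bigr => a _ do rewrite mxE mulr_sumr.
under [RHS]eq_bigr => a _ do rewrite mxE mulr_sumr.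
rewrite exchange_big /=; apply: eq_bigr => a _; apply: eq_bigr => b _.
by rewrite (christoffel_sym Ox); ring.
Qed.

Lemma conn_metric u x : O x -> 'D_u g x = conn g u x *m g x + g x *m (conn g u x)^T.
Proof.
move=> Ox; apply: bilin_inj => v w.
have Sg := metric_msmooth.
have S1 m p (a : 'M[R]_(m, p)) := @msmooth_cst R _ O m p a.
have := @nabla_metric R n H i x Ox (cst u) (cst v) (cst w).
rewrite !nabla_cstl /= !derive_cst !add0r.
move=> /(_ (derivable_cst _ _ _) (derivable_cst _ _ _)) E.
have -> : bilin ('D_u g x) v w = 'D_u (fun y => bilin (g y) v w) x.
  have Svg : msmooth O (fun y => v *m g y) by exact: msmoothM.
  have Svgw : msmooth O (fun y => v *m g y *m w^T) by exact: (msmoothM openO Svg (S1 _ _ w^T)).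
  have := derive_coord 0 0 (msmooth_derivable (v := u) Svgw Ox).
  rewrite (derive_msmoothM openO u Ox Svg (S1 _ _ w^T)) derive_cst mulmx0 addr0.
  by rewrite (derive_msmoothM openO u Ox (S1 _ _ v) Sg) derive_cst mul0mx add0r.
rewrite E /bilin trmx_mul mulmxDr mulmxDl [RHS]mxE !mulmxA //.
Qed.

(** Constant fields have zero bracket, and rows are multiplied on the right, which reverses the
    products of connection matrices. *)
Lemma curvature_riem x u v w : O x ->
  curvature g x u v w = w *m riem (conn g) u v x.
Proof.
move=> Ox.
have S1 := @msmooth_cst R _ O 1 n w.
have E a b : nabla g (cst a) (nabla g (cst b) (cst w)) x =
    w *m 'D_a (conn g b) x + w *m conn g b x *m conn g a x.
  have -> : nabla g (cst b) (cst w) = fun y => w *m conn g b y.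
    by apply/funext => y; rewrite nabla_cstl derive_cst add0r.
  rewrite nabla_cstl (derive_msmoothM openO a Ox S1 (conn_msmooth b)) derive_cst.
  by rewrite mul0mx add0r.
have L : lie_bracket (cst u) (cst v) = cst (0 : 'rV[R]_n).
  by apply/funext => y; rewrite /lie_bracket !derive_cst subrr.
have C0 : conn g 0 x = 0.
  by apply/matrixP => j k; rewrite !mxE big1 // => a _; rewrite mxE mul0r.
rewrite /curvature /curvature_field !E L nabla_cstl derive_cst add0r C0 mulmx0 subr0.
rewrite /riem !mulmxDr !mulmxN !mulmxA opprD addrACA //.
Qed.

Lemma chart_kaehler x : kaehler_identity H -> O x ->
  kaehler_curvature (g x) (J x) (fun u v => riem (conn g) u v x).
Proof.
move=> kH Ox.
have lin (A : 'rV[R]_n -> 'M[R]_n) a u v : msmooth O A ->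
    'D_(a *: u + v) A x = a *: 'D_u A x + 'D_v A x.
  by move=> SA; exact: (msmooth_derive_linear Ox SA).
have Dlin a u v w : 'D_w (conn g (a *: u + v)) x =
    a *: 'D_w (conn g u) x + 'D_w (conn g v) x.
  have -> : conn g (a *: u + v) = fun y => a *: conn g u y + conn g v y.
    by apply/funext => y; exact: conn_linear.
  have Sa := msmoothZ openO (dsmooth_cst O a) (conn_msmooth u).
  rewrite (derive_msmoothD w Ox Sa (conn_msmooth v)).
  rewrite (derive_msmoothZ openO w Ox (dsmooth_cst O a) (conn_msmooth u)).
  by rewrite derive_cst scale0r add0r.
have rlin a u v w : riem (conn g) (a *: u + v) w x =
    a *: riem (conn g) u w x + riem (conn g) v w x.
  have key (p q r s m k l : 'M[R]_n) : a *: p + q - (a *: r + s) +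
      (m *m (a *: k + l) - (a *: k + l) *m m) =
      a *: (p - r + (m *m k - k *m m)) + (q - s + (m *m l - l *m m)).
    rewrite mulmxDl mulmxDr -scalemxAl -scalemxAr.
    by move: (m *m k) (k *m m) (m *m l) (l *m m) => *; apply/matrixP => ? ?; rewrite !mxE; ring.
  rewrite /riem lin ?Dlin ?conn_linear; first exact: key.
  exact: conn_msmooth.
have r0 w : riem (conn g) 0 w x = 0.
  by have := rlin (-1) 0 0 w; rewrite scaler0 addr0 scaleN1r addNr.
split=> [u v w|a u w|u v|u v|u v w|u v].
- by have := rlin 1 u v w; rewrite !scale1r.
- by have := rlin a u 0 w; rewrite addr0 r0 addr0.
- by rewrite /riem opprD !opprB.
- exact: (riem_skew openO conn_msmooth metric_msmooth conn_metric Ox).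
- exact: (first_bianchi openO conn_msmooth conn_torsion Ox).
- case: Ox => p dp px; apply: eq_mulmx_row => z.
  rewrite -!curvature_riem; try by exists p.
  by have := kH i p dp u v z; rewrite /R_at /J_at -px.
Qed.

End Chart.

Section PointOfChart.
Variables (R : realType) (n : nat) (H : almost_hermitian_manifold R n).
Variables (i : chart H) (p : H).
Hypothesis dp : dom i p.
Let x := phi i p.
Let Ox : (phi i @` dom i) x. Proof. by exists p. Qed.
Let Rm u v := riem (conn (metric i)) u v x.

Lemma hol_sect_curvE v : hol_sect_curv i p v =
  bilin (metric i x) (v *m acs i x *m Rm v (v *m acs i x)) v.
Proof. by rewrite /hol_sect_curv /R4_at /g_at /R_at /J_at curvature_riem. Qed.

Lemma jacobi_opE v : kaehler_identity H ->
  jacobi_op i p v + jacobi_op i p (v *m J_at i p) = complex_jacobi (acs i x) Rm v.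
Proof.
move=> kH; apply/row_matrixP => k.
have E w : row k (jacobi_op i p w) = w *m Rm (delta_mx 0 k) w.
  by apply/rowP => j; rewrite [LHS]mxE [LHS]mxE /R_at curvature_riem.
rewrite raddfD /= !E /J_at rowE /complex_jacobi.
exact: (kc_jacobi (chart_compatible Ox) (chart_kaehler kH Ox)).
Qed.

(** In rank one [v *m J] would be a multiple of [v], with factor zero by orthogonality, against J^2
    = -1. *)
Lemma complex_line_unit v : g_at i p v v = 1 -> complex_line i p (v + v *m J_at i p)%MS.
Proof.
move=> v1; have hJ := chart_compatible Ox; rewrite -/x in hJ.
have v0 : v != 0.
  by apply: contra_eq_neq v1 => ->; rewrite /g_at bilin0l eq_sym oner_neq0.
have vJJ : v *m J_at i p *m J_at i p = - v by exact: (herm_mulJJ hJ).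
split.
  apply/eqP; rewrite eqn_leq; apply/andP; split.
    apply: leq_trans (mxrank_adds_leqif _ _).1 _.
    by rewrite -[2%N]/(1 + 1)%N leq_add // rank_leq_row.
  have v_le : (v <= v + v *m J_at i p)%MS by exact: addsmxSl.
  rewrite ltnNge; apply/negP => r1.
  have : (v + v *m J_at i p <= v)%MS.
    have [_ e] := mxrank_leqif_sup v_le; rewrite -e rank_rV v0 /=.
    by rewrite eqn_leq r1 andbT (leq_trans _ (mxrankS v_le)) // rank_rV v0.
  rewrite addsmx_sub => /andP[_ /sub_rVP[a aJ]].
  have : bilin (metric i x) v (v *m J_at i p) = 0 by exact: (herm_bilin_Jself hJ).
  rewrite aJ bilinZr [bilin _ v v]v1 mulr1 => a0.
  by move: vJJ; rewrite aJ a0 scale0r mul0mx => /esym/eqP; rewrite oppr_eq0 (negPf v0).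
apply/andP; split; rewrite ?addsmxMr addsmx_sub ?vJJ ?eqmx_opp.
  by rewrite addsmxSr (submx_trans _ (addsmxSl _ _)) // eqmx_opp.
have -> : (v <= v *m J_at i p + - v)%MS by rewrite (submx_trans _ (addsmxSr _ _)) // eqmx_opp.
by rewrite addsmxSl.
Qed.

End PointOfChart.

(** * The theorem *)

Lemma rank_eigenspace_conj (R : realType) n (S D : 'M[R]_n) l : S \in unitmx ->
  \rank (eigenspace (invmx S *m D *m S) l) = \rank (eigenspace D l).
Proof.
move=> uS; rewrite !mxrank_ker; congr (_ - _)%N.
have -> : invmx S *m D *m S - l%:M = invmx S *m (D - l%:M) *m S.
  rewrite mulmxBr mulmxBl; congr (_ - _).
  by rewrite scalar_mxC -mulmxA mulVmx// mulmx1.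
rewrite mxrankMfree ?row_free_unit//.
by apply: eqmx_rank; apply/eqmxP/eqmxMfull; rewrite row_full_unit unitmx_inv.
Qed.

Section MainTheorem.
Variables (R : realType) (H : almost_hermitian_manifold R 4).
Hypothesis kH : kaehler_identity H.
Let Rm (i : chart H) x u v := riem (conn (metric i)) u v x.
Let A (i : chart H) (p : H) v := complex_jacobi (acs i (phi i p)) (Rm i (phi i p)) v.

Let inO (i : chart H) p : dom i p -> (phi i @` dom i) (phi i p).
Proof. by move=> dp; exists p. Qed.

Let chc (i : chart H) p (dp : dom i p) := chart_compatible (inO dp).
Let chk (i : chart H) p (dp : dom i p) := chart_kaehler kH (inO dp).

Lemma complex_jacobi_op_unit (i : chart H) p v : dom i p -> g_at i p v v = 1 ->
  complex_jacobi_op i p (v + v *m J_at i p)%MS (A i p v).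
Proof.
move=> dp v1; exists v; split=> //; first exact: addsmxSl.
by rewrite jacobi_opE.
Qed.

Lemma osserman_chsc : complex_osserman H -> constant_hol_sect_curv H.
Proof.
move=> [_ spec].
(* An empty manifold offers no reference point; any constant will do there. *)
have [[i0 [p0 d0]]|none] := pselect (exists (i : chart H) p, dom i p); last first.
  by exists 0 => i p x dp; case: none; exists i, p.
have [e e1] := unit_vector (chc d0).
pose al := mean (A i0 p0 e); pose ro := deviation (A i0 p0 e).
have const (i : chart H) p (dp : dom i p) v : bilin (metric i (phi i p)) v v = 1 ->
    mean (A i p v) = al /\ deviation (A i p v) = ro.
  move=> v1; apply: two_valued_eq_spectrum.
  - exact: (complex_jacobi_two_valued (chc dp) (chk dp)).
  - exact: (complex_jacobi_two_valued (chc d0) (chk d0)).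
  move=> l; rewrite /eigenvalue -!mxrank_eq0; congr (~~ (_ == _)).
  exact: (spec _ _ _ _ _ _ _ _ dp d0 (complex_line_unit dp v1)
    (complex_jacobi_op_unit dp v1) (complex_line_unit d0 e1)
    (complex_jacobi_op_unit d0 e1) l).
have main (i : chart H) p (dp : dom i p) := pointwise_osserman (chc dp) (chk dp) (const i p dp).
(* The condition concerns global constants only, so in the first case every point of the chart [i0]
   is exceptional. *)
have [[roal al0]|nex] := pselect (ro = al ^+ 2 /\ al != 0).
  have al0' : - al != 0 by rewrite oppr_eq0.
  case: (@no_exceptional_chart R (phi i0 @` dom i0) (@phi_open R 4 H i0)
    (conn (metric i0)) (@conn_msmooth R 4 H i0) (metric i0) (acs i0) (- al)
    (@metric_msmooth R 4 H i0) (@acs_msmooth R 4 H i0) (@conn_metric R 4 H i0)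
    (@conn_torsion R 4 H i0) (@chart_compatible R 4 H i0) _ al0' _ _ (inO d0)).
  - move=> u v x Ox; exact: (kc_commJ (chart_compatible Ox) (chart_kaehler kH Ox)).
  - by move=> x [p dp <-]; have [_ ex] := main i0 p dp; exact: ex.
exists (4 / 3 * al) => i p x dp x1; rewrite hol_sect_curvE//.
have [hol _] := main i p dp; apply: hol => //.
have [al0|al0] := eqVneq al 0; first by right.
by left; apply/eqP => roal; apply: nex.
Qed.

(** The normal form of [pointwise_chsc] depends on [c] alone, so all complex Jacobi operators are
    conjugate to one matrix; commutation with [J] comes from [kc_commJ]. *)
Lemma chsc_osserman : constant_hol_sect_curv H -> complex_osserman H.
Proof.
move=> [c Hc].
have AE (i : chart H) p P B : dom i p -> complex_jacobi_op i p P B ->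
    exists2 v, bilin (metric i (phi i p)) v v = 1 & B = A i p v.
  by move=> dp [v [_ v1 ->]]; exists v => //; rewrite jacobi_opE.
have diagE (i : chart H) p v (dp : dom i p) : bilin (metric i (phi i p)) v v = 1 ->
    exists2 S : 'M[R]_4, S \in unitmx & A i p v = invmx S *m
      (\matrix_(i, j) ((i == j)%:R * (if (i < 2)%N then c else c / 2))) *m S.
  move=> v1; apply: (pointwise_chsc (chc dp) (chk dp)) v1 => x x1.
  by rewrite -hol_sect_curvE//; exact: Hc.
split=> [i p P B dp _ /(AE _ _ _ _ dp)[v _ ->]|].
  rewrite /comm_mx /A /complex_jacobi /J_at mulmxA.
  by rewrite -(kc_commJ (chc dp) (chk dp)).
move=> i j p q P Q B C dp dq _ /(AE _ _ _ _ dp)[v v1 ->] _ /(AE _ _ _ _ dq)[w w1 ->] l.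
have [S uS ->] := diagE i p v dp v1; have [T uT ->] := diagE j q w dq w1.
exact: etrans (rank_eigenspace_conj _ l uS) (esym (rank_eigenspace_conj _ l uT)).
Qed.

End MainTheorem.

Theorem theorem1p9 (R : realType) (H : almost_hermitian_manifold R 4) :
  kaehler_identity H -> (complex_osserman H <-> constant_hol_sect_curv H).
Proof.
by move=> kH; split; [exact: osserman_chsc|exact: chsc_osserman].
Qed.
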